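(* If a graph $U$ contains every planar graph, then for every $t\in\mathbb{N}$, $U$ contains a subdivision of $K_t^t$; that is, $U$ contains $t$ distinct vertices $w_1,\dots,w_t$ and, for each pair $i<j$, $t$ paths between $w_i$ and $w_j$, such that all these $t\binom{t}{2}$ paths are pairwise internally vertex-disjoint and no internal vertex of any of them is among $w_1,\dots,w_t$.
   Context: All graphs are simple and countable; $U$ contains $H$ if $H$ is isomorphic to a subgraph of $U$. $K_t^t$ denotes the multigraph on $t$ vertices with $t$ parallel edges between every pair of vertices. *)

(* Defs.v *)
From Stdlib Require Import Reals List.
Import ListNotations.
Open Scope R_scope.

Definition countable_simple_graph {V : Type} (adj : V -> V -> Prop) : Prop :=
  (forall x y, adj x y -> adj y x) /\
  (forall x, ~ adj x x) /\
  (exists f : V -> nat, forall x y, f x = f y -> x = y).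

Definition contains {VU VH : Type} (adjU : VU -> VU -> Prop)
  (adjH : VH -> VH -> Prop) : Prop :=
  exists f : VH -> VU,
    (forall x y, f x = f y -> x = y) /\
    (forall x y, adjH x y -> adjU (f x) (f y)).

(** Planarity: an embedding in the plane R^2.  Vertices go to distinct
    points; each edge xy goes to an arc, i.e. a continuous curve
    s |-> (g1 s, g2 s) that is injective on [0,1], starts at the point of x
    and ends at the point of y; the interior of an arc contains no vertex
    point, and interiors of arcs of distinct edges are disjoint. *)
Definition open01 (s : R) : Prop := 0 < s < 1.
Definition closed01 (s : R) : Prop := 0 <= s <= 1.

Definition planar {V : Type} (adj : V -> V -> Prop) : Prop :=
  exists (px py : V -> R) (g1 g2 : V -> V -> R -> R),
    (forall x y, px x = px y -> py x = py y -> x = y) /\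
    (forall x y, adj x y ->
       continuity (g1 x y) /\ continuity (g2 x y) /\
       g1 x y 0 = px x /\ g2 x y 0 = py x /\
       g1 x y 1 = px y /\ g2 x y 1 = py y /\
       (forall s s', closed01 s -> closed01 s' ->
          g1 x y s = g1 x y s' -> g2 x y s = g2 x y s' -> s = s') /\
       (forall z s, open01 s -> ~ (g1 x y s = px z /\ g2 x y s = py z))) /\
    (forall x y u v, adj x y -> adj u v ->
       ~ ((u = x /\ v = y) \/ (u = y /\ v = x)) ->
       forall s s', open01 s -> open01 s' ->
         ~ (g1 x y s = g1 u v s' /\ g2 x y s = g2 u v s')).

Fixpoint walk {V : Type} (adj : V -> V -> Prop) (a : V) (l : list V) (b : V)
  : Prop :=
  match l with
  | nil => adj a b
  | x :: l' => adj a x /\ walk adj x l' b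
  end.

Definition path_with_interior {V : Type} (adj : V -> V -> Prop)
  (a : V) (l : list V) (b : V) : Prop :=
  walk adj a l b /\ NoDup (a :: l ++ [b]).

Definition has_subdivision_Ktt {V : Type} (adj : V -> V -> Prop) (t : nat)
  : Prop :=
  exists (w : nat -> V) (P : nat -> nat -> nat -> list V),
    (forall i j, (i < t)%nat -> (j < t)%nat -> w i = w j -> i = j) /\
    (forall i j k, (i < j)%nat -> (j < t)%nat -> (k < t)%nat ->
       path_with_interior adj (w i) (P i j k) (w j)) /\
    (forall i j k m x, (i < j)%nat -> (j < t)%nat -> (k < t)%nat ->
       (m < t)%nat -> In x (P i j k) -> x <> w m) /\
    (forall i j k k', (i < j)%nat -> (j < t)%nat -> (k < t)%nat ->
       (k' < t)%nat -> k <> k' -> P i j k <> P i j k') /\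
    (forall i j k i' j' k' x,
       (i < j)%nat -> (j < t)%nat -> (k < t)%nat ->
       (i' < j')%nat -> (j' < t)%nat -> (k' < t)%nat ->
       (i, j, k) <> (i', j', k') ->
       In x (P i j k) -> ~ In x (P i' j' k')).

(* Main.v *)
Require Import Defs.
From Stdlib Require Import Reals List Lia Lra Psatz ZArith Arith.
From Stdlib Require Import Classical ClassicalEpsilon Cantor FinFun Permutation.
Import ListNotations.

(** For each binary sequence [al] take the spiral on the natural numbers with edges [k -- k+1] and [k -- k+n],
    together with [t] hubs inside the first arm and, in the [k]-th quadrilateral, the diagonal prescribed by [al k].
    These graphs are planar, so each embeds in [U]. There are uncountably many of them and [U] is countable; if each
    embedding were finally flat in [U], two of them would agree on a long initial piece of the spiral but differ later,
    and at the first place where they part (or where their diagonals cross) one would supply a path of [U] that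
    leaves the cylinder formed by the other: a contradiction. So some embedded spiral carries, arbitrarily far out and
    avoiding any finite set, paths of [U] that make two of its [n] rays exchange their sides. Tokens that leave the hubs
    and travel outwards along the rays can then overtake one another, hence be brought next to their partners, in
    any prescribed pairing; their traces are the required disjoint paths. *)

(** * A planar drawing of the spiral graphs *)

(** The numbering along a spiral replaces the rows and columns of a grid by one well-ordered
    sequence, in which a late vertex [y] has two earlier neighbours, [y - 1] and [y - n]. The first
    vertex at which two embedded spirals differ therefore hangs on two vertices common to both, and
    this gives detours with known ends. The diagonals serve the case of two different codes with the
    same embedded spiral: some quadrilateral then has both its diagonals in [U]. A detour to a
    distant ray is a [chord]; one that returns to the same or a neighbouring ray need not exchange
    rays by itself, hence the second kind of event, [bypass]. Events are wanted for all [c] and [Z],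
    since each new detour must lie beyond the part of the spiral already used and miss the finitely
    many outside vertices already spent. Both ends of every desired path travel as tokens, one per
    ray, in a cyclic order that overtaking changes by a transposition. The width [n] is at least
    twice the number of tokens, so that a chord, taken the short way round, leaves enough rays for
    all the other tokens. *)

Section EdgeCurves.
Context {V E : Type} (adj : V -> V -> Prop) (ok : E -> Prop) (src tgt : E -> V).
Context (px py : V -> R) (cx cy : E -> R -> R) (e0 : E).

(** [planar] asks for a curve for every ordered pair of adjacent vertices. Drawing each edge once is
    enough: a pair is assigned an edge by choice, and the curve is run backwards, by [1 - s], when
    the pair opposes the direction of the edge. *)
Lemma planar_of_edge_curves :
  (forall x y, adj x y -> exists e, ok e /\
     ((src e = x /\ tgt e = y) \/ (src e = y /\ tgt e = x))) ->
  (forall x y, px x = px y -> py x = py y -> x = y) ->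
  (forall e, continuity (cx e) /\ continuity (cy e)) ->
  (forall e, ok e -> cx e 0 = px (src e) /\ cy e 0 = py (src e) /\
     cx e 1 = px (tgt e) /\ cy e 1 = py (tgt e)) ->
  (forall e s s', ok e -> closed01 s -> closed01 s' ->
     cx e s = cx e s' -> cy e s = cy e s' -> s = s') ->
  (forall e z s, ok e -> open01 s -> ~ (cx e s = px z /\ cy e s = py z)) ->
  (forall e e' s s', ok e -> ok e' -> open01 s -> open01 s' ->
     cx e s = cx e' s' -> cy e s = cy e' s' -> e = e') ->
  planar adj.
Proof.
intros Hadj Hpos Hcont Hend Hinj Hvert Hdisj.
assert (Hch : forall q : V * V, { p : E * bool | adj (fst q) (snd q) ->
   ok (fst p) /\ if snd p then src (fst p) = fst q /\ tgt (fst p) = snd q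
                 else src (fst p) = snd q /\ tgt (fst p) = fst q }).
{ intros [x y]. apply constructive_indefinite_description. cbn.
  destruct (classic (adj x y)) as [H|H].
  - destruct (Hadj x y H) as [e [He [H1|H1]]].
    + exists (e, true). cbn. tauto.
    + exists (e, false). cbn. tauto.
  (* Nonadjacent pairs receive the default edge [e0]; nothing is claimed about them. *)
  - exists (e0, true). tauto. }
pose (ed x y := fst (proj1_sig (Hch (x, y)))).
pose (dir x y := snd (proj1_sig (Hch (x, y)))).
assert (Hed : forall x y, adj x y -> ok (ed x y) /\
   if dir x y then src (ed x y) = x /\ tgt (ed x y) = y
              else src (ed x y) = y /\ tgt (ed x y) = x).
{ intros x y Hxy. unfold ed, dir. destruct (Hch (x, y)) as [p Hp]. cbn in *. auto. }
clearbody ed dir. clear Hch.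
pose (par x y s := if dir x y then s else 1 - s).
assert (Hpo : forall x y s, open01 s -> open01 (par x y s)).
{ intros x y s. unfold open01, par. destruct (dir x y); lra. }
assert (Hpc : forall x y s, closed01 s -> closed01 (par x y s)).
{ intros x y s. unfold closed01, par. destruct (dir x y); lra. }
assert (Hcomp : forall f b, continuity f ->
   continuity (fun s => f (if b : bool then s else 1 - s))).
{ intros f b Hf. destruct b; [exact Hf|].
  apply (continuity_comp (fun s => 1 - s) f); [|exact Hf].
  apply derivable_continuous. reg. }
exists px, py, (fun x y s => cx (ed x y) (par x y s)), (fun x y s => cy (ed x y) (par x y s)).
split; [exact Hpos|]. split.
- intros x y Hxy. destruct (Hed x y Hxy) as [Hok Hd].
  destruct (Hend _ Hok) as (E1 & E2 & E3 & E4).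
  split; [apply Hcomp, Hcont|]. split; [apply Hcomp, Hcont|].
  assert (Hends : cx (ed x y) (par x y 0) = px x /\ cy (ed x y) (par x y 0) = py x /\
                  cx (ed x y) (par x y 1) = px y /\ cy (ed x y) (par x y 1) = py y).
  { unfold par. destruct (dir x y); destruct Hd as [S T].
    - rewrite E1, E2, E3, E4, S, T. auto.
    - replace (1 - 0) with 1 by ring. replace (1 - 1) with 0 by ring.
      rewrite E1, E2, E3, E4, S, T. auto. }
  destruct Hends as (F1 & F2 & F3 & F4). repeat (split; [assumption|]). split.
  + intros s s' Hs Hs' H1 H2.
    assert (H := Hinj _ _ _ Hok (Hpc x y s Hs) (Hpc x y s' Hs') H1 H2).
    unfold par in H. destruct (dir x y); lra.
  + intros z s Hs. apply Hvert; auto.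
- intros x y u v Hxy Huv Hne s s' Hs Hs' [H1 H2].
  destruct (Hed x y Hxy) as [Hok Hd]. destruct (Hed u v Huv) as [Hok' Hd'].
  assert (He := Hdisj _ _ _ _ Hok Hok' (Hpo x y s Hs) (Hpo u v s' Hs') H1 H2).
  rewrite <- He in Hd'. apply Hne.
  destruct (dir x y), (dir u v); destruct Hd, Hd'; subst; intuition congruence.
Qed.
End EdgeCurves.

(** * The spiral graphs and their drawing by segments in spiral coordinates *)

Section Spiral.
Context (n t M : nat) (al : nat -> bool).
Context (Hn : (2 <= n)%nat) (HM : (1 <= M)%nat) (HMn : (M < n)%nat) (HtM : (t * M <= n)%nat).

Definition spiral_vertex : Type := nat + nat.

Inductive spiral_edge : Type :=
| arm (k : nat) | radial (k : nat) | diagonal (k : nat) | spoke (p r : nat).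

Definition valid_edge (e : spiral_edge) : Prop :=
  match e with
  | spoke p r => (p < t /\ p * M <= r < p * M + M)%nat
  | _ => True
  end.

Definition edge_src (e : spiral_edge) : spiral_vertex :=
  match e with
  | arm k | radial k => inl k
  | diagonal k => inl (if al k then k else S k)
  | spoke p r => inr p
  end.

Definition edge_tgt (e : spiral_edge) : spiral_vertex :=
  match e with
  | arm k => inl (S k)
  | radial k => inl (k + n)%nat
  | diagonal k => inl (if al k then S k + n else k + n)%nat
  | spoke p r => inl r
  end.

Definition spiral_adj (x y : spiral_vertex) : Prop :=
  exists e, valid_edge e /\
    ((edge_src e = x /\ edge_tgt e = y) \/ (edge_src e = y /\ edge_tgt e = x)).

Lemma spiral_graph : countable_simple_graph spiral_adj.
Proof.
split; [|split].
- intros x y [e [He H]]. exists e. tauto.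
- intros x [e [He H]].
  assert (edge_src e = edge_tgt e) by (destruct H as [[? ?]|[? ?]]; congruence).
  destruct e; cbn in *; try destruct (al k);
  match goal with H : inl _ = inl _ |- _ => injection H; lia | _ => discriminate end.
- exists (fun x => match x with inl k => 2 * k | inr p => 2 * p + 1 end)%nat.
  intros [k|p] [k'|p'] H; f_equal; lia.
Qed.

Local Notation N := (INR n).

(* Coordinates [(u, h)] adapted to an Archimedean spiral: [h = 0] is the spiral itself, and since [(u, N)]
   is the same point as [(u + N, 0)], the strip between two consecutive arms is [0 <= h <= N]. Hubs lie
   inside the first arm, at [h < 0]; those of index at least [t] are isolated vertices parked near the
   origin. *)
Definition spiral_x (u h : R) : R := (u + 1 + h) * cos (2 * PI * u / N).
Definition spiral_y (u h : R) : R := (u + 1 + h) * sin (2 * PI * u / N).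

Lemma N_ge2 : 2 <= N.
Proof. change 2 with (INR 2). now apply le_INR. Qed.

Lemma cos_sin_eq a b : cos a = cos b -> sin a = sin b ->
  exists z : Z, a - b = 2 * PI * IZR z.
Proof.
intros Hc Hs.
assert (H : cos (a - b) = 1).
{ rewrite cos_minus, Hc, Hs. generalize (sin2_cos2 b). unfold Rsqr. lra. }
assert (H2 : sin ((a - b) / 2) = 0).
{ replace (a - b) with (2 * ((a - b) / 2)) in H by field.
  rewrite cos_2a_sin in H. nra. }
destruct (sin_eq_0_0 _ H2) as [k Hk]. exists k. lra.
Qed.

(** A point determines its radius [u + 1 + h], and its angle up to full turns; equality of the radii
    turns a shift of [u] into the opposite shift of [h]. *)
Lemma spiral_coord_eq u h u' h' :
  0 < u + 1 + h -> 0 < u' + 1 + h' ->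
  spiral_x u h = spiral_x u' h' -> spiral_y u h = spiral_y u' h' ->
  exists z : Z, u - u' = N * IZR z /\ h' - h = N * IZR z.
Proof.
unfold spiral_x, spiral_y.
set (r := u + 1 + h). set (r' := u' + 1 + h').
set (a := 2 * PI * u / N). set (b := 2 * PI * u' / N).
intros Hr Hr' Hx Hy.
assert (HN := N_ge2).
assert (Hrr : r = r').
{ generalize (sin2_cos2 a) (sin2_cos2 b). unfold Rsqr. intros Ha Hb.
  assert (r * r = r' * r').
  { transitivity ((r * cos a) * (r * cos a) + (r * sin a) * (r * sin a)).
    - transitivity (r * r * (sin a * sin a + cos a * cos a)); [rewrite Ha|]; ring.
    - rewrite Hx, Hy.
      transitivity (r' * r' * (sin b * sin b + cos b * cos b)); [|rewrite Hb]; ring. }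
  nra. }
rewrite <- Hrr in Hx, Hy.
apply Rmult_eq_reg_l in Hx; [|lra]. apply Rmult_eq_reg_l in Hy; [|lra].
destruct (cos_sin_eq a b Hx Hy) as [z Hz]. exists z.
assert (Hu : u - u' = N * IZR z).
{ assert (HP := PI_RGT_0).
  apply (Rmult_eq_reg_l (2 * PI)); [|lra].
  transitivity (N * (a - b)); [unfold a, b; field; lra|rewrite Hz; ring]. }
split; [exact Hu|].
unfold r, r' in Hrr. lra.
Qed.

Definition spiral_domain (u h : R) : Prop :=
  (0 <= u /\ 0 <= h < N) \/ (0 <= u < N /\ -1 < h < 0).

(** The bounds on [h] leave at most one turn between the two pairs, and exactly one turn is excluded
    by the same bounds or by [u < N] inside the first arm. *)
Lemma spiral_domain_inj u h u' h' :
  spiral_domain u h -> spiral_domain u' h' ->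
  spiral_x u h = spiral_x u' h' -> spiral_y u h = spiral_y u' h' -> u = u' /\ h = h'.
Proof.
intros D D' Hx Hy. assert (HN := N_ge2).
assert (P : 0 < u + 1 + h) by (destruct D; lra).
assert (P' : 0 < u' + 1 + h') by (destruct D'; lra).
destruct (spiral_coord_eq _ _ _ _ P P' Hx Hy) as [z [Hu Hh]].
assert (Hz : (z = 0 \/ z = 1 \/ z = -1)%Z).
{ assert (H1 : -2 < IZR z) by (destruct D as [[? ?]|[? ?]], D' as [[? ?]|[? ?]]; nra).
  assert (H2 : IZR z < 2) by (destruct D as [[? ?]|[? ?]], D' as [[? ?]|[? ?]]; nra).
  apply lt_IZR in H1. apply lt_IZR in H2. lia. }
destruct Hz as [-> | [-> | ->]];
  destruct D as [[? ?]|[? ?]], D' as [[? ?]|[? ?]]; split; lra.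
Qed.

Definition vertex_u (x : spiral_vertex) : R :=
  match x with
  | inl k => INR k
  | inr p => if lt_dec p t then INR (p * M) else 0
  end.
Definition vertex_h (x : spiral_vertex) : R :=
  match x with
  | inl k => 0
  | inr p => if lt_dec p t then - (1 / 2) else / (INR p + 3) - 1
  end.

(** Edges are segments in the [(u, h)] plane. Terms such as [0 * s] and [1 * s] are kept so that all
    of them fit one affine pattern, for which continuity is proved once. *)
Definition edge_u (e : spiral_edge) (s : R) : R :=
  match e with
  | arm k => INR k + 1 * s
  | radial k => INR k + 0 * s
  | diagonal k => if al k then INR k + 1 * s else INR k + 1 + (-1) * s
  | spoke p r => INR (p * M) + (INR r - INR (p * M)) * s
  end.
Definition edge_h (e : spiral_edge) (s : R) : R :=
  match e with
  | arm k => 0 + 0 * s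
  | radial k => 0 + N * s
  | diagonal k => 0 + N * s
  | spoke p r => - (1 / 2) + (1 / 2) * s
  end.

Lemma hub_below p : (p < t)%nat -> (p * M + M <= n)%nat.
Proof. nia. Qed.

Lemma vertex_domain x : spiral_domain (vertex_u x) (vertex_h x).
Proof.
assert (HN := N_ge2). destruct x as [k|p]; cbn.
- left. assert (H := pos_INR k). lra.
- right. destruct (lt_dec p t) as [H|H].
  + assert (H1 := pos_INR (p * M)). split; [|lra]. split; [lra|].
    assert (Hb := hub_below p H). apply lt_INR. lia.
  + assert (Hp := pos_INR p). split; [lra|].
    assert (0 < / (INR p + 3)) by (apply Rinv_0_lt_compat; lra).
    assert (/ (INR p + 3) < / 1) by (apply Rinv_lt_contravar; lra).
    lra.
Qed.

Lemma vertex_coord_inj x y :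
  vertex_u x = vertex_u y -> vertex_h x = vertex_h y -> x = y.
Proof.
assert (Hinv : forall p, 0 < / (INR p + 3) <= 1 / 3).
{ intros p. assert (Hp := pos_INR p). split; [apply Rinv_0_lt_compat; lra|].
  replace (1 / 3) with (/ 3) by lra. apply Rinv_le_contravar; lra. }
destruct x as [k|p], y as [k'|p']; cbn; intros Hu Hh.
- apply INR_eq in Hu. congruence.
- exfalso. destruct (lt_dec p' t); [lra|]. assert (H := Hinv p'). lra.
- exfalso. destruct (lt_dec p t); [lra|]. assert (H := Hinv p). lra.
- assert (H := Hinv p). assert (H' := Hinv p').
  destruct (lt_dec p t) as [L|L], (lt_dec p' t) as [L'|L']; try lra.
  + apply INR_eq in Hu. f_equal. nia.
  + f_equal. apply INR_eq. apply (Rplus_eq_reg_r 3).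
    rewrite <- (Rinv_inv (INR p + 3)), <- (Rinv_inv (INR p' + 3)). f_equal. lra.
Qed.

Lemma vertex_inj x y :
  spiral_x (vertex_u x) (vertex_h x) = spiral_x (vertex_u y) (vertex_h y) ->
  spiral_y (vertex_u x) (vertex_h x) = spiral_y (vertex_u y) (vertex_h y) -> x = y.
Proof.
intros Hx Hy.
destruct (spiral_domain_inj _ _ _ _ (vertex_domain x) (vertex_domain y) Hx Hy).
now apply vertex_coord_inj.
Qed.

Lemma spoke_range p r s : (p < t)%nat -> (p * M <= r < p * M + M)%nat -> closed01 s ->
  INR (p * M) <= INR (p * M) + (INR r - INR (p * M)) * s /\
  INR (p * M) + (INR r - INR (p * M)) * s <= INR (p * M) + (INR M - 1) /\
  INR (p * M) + INR M <= N.
Proof.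
intros Hp [Hr1 Hr2] [Hs1 Hs2].
assert (Hb := hub_below p Hp). apply le_INR in Hb. rewrite plus_INR in Hb.
apply le_INR in Hr1. apply Nat.le_succ_l, le_INR in Hr2.
rewrite S_INR, plus_INR in Hr2. repeat split; nra.
Qed.

Lemma edge_domain e s : valid_edge e -> open01 s -> spiral_domain (edge_u e s) (edge_h e s).
Proof.
intros He [Hs1 Hs2]. assert (HN := N_ge2).
destruct e as [k|k|k|p r]; cbn.
- left. assert (H := pos_INR k). lra.
- left. assert (H := pos_INR k). nra.
- left. assert (H := pos_INR k). destruct (al k); split; nra.
- right. destruct He as [Hp Hr].
  destruct (spoke_range p r s Hp Hr) as (H1 & H2 & H3); [unfold closed01; lra|].
  assert (H4 := pos_INR (p * M)). lra.
Qed.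

Lemma INR_eq_of_close a b : -1 < INR a - INR b < 1 -> a = b.
Proof.
intros H. rewrite !INR_IZR_INZ, <- minus_IZR in H. destruct H as [H1 H2].
apply lt_IZR in H1. apply lt_IZR in H2. lia.
Qed.

Lemma INR_not_between a b s : 0 < s < 1 -> INR a <> INR b + s.
Proof.
intros Hs H. assert (a = b) by (apply INR_eq_of_close; lra). subst. lra.
Qed.

Lemma edge_avoids_vertex e z s : valid_edge e -> open01 s ->
  edge_u e s = vertex_u z -> edge_h e s = vertex_h z -> False.
Proof.
intros He Hs Hu Hh. assert (HN := N_ge2). unfold open01 in Hs.
assert (Hz : vertex_h z = 0 /\ (exists k, vertex_u z = INR k) \/ vertex_h z <= - (1 / 2)).
{ destruct z as [k|p]; cbn; [left; eauto|right].
  destruct (lt_dec p t); [lra|].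
  assert (Hp := pos_INR p).
  assert (/ (INR p + 3) <= / 3) by (apply Rinv_le_contravar; lra). lra. }
destruct e as [k|k|k|p r]; cbn in Hu, Hh; destruct Hz as [[Hz [j Hj]]|Hz]; try nra.
apply (INR_not_between j k s); lra.
Qed.

Lemma spokes_of_distinct_hubs p r p' r' s s' :
  (p < p')%nat -> (p' < t)%nat ->
  (p * M <= r < p * M + M)%nat -> (p' * M <= r' < p' * M + M)%nat ->
  closed01 s -> closed01 s' ->
  INR (p * M) + (INR r - INR (p * M)) * s <> INR (p' * M) + (INR r' - INR (p' * M)) * s'.
Proof.
intros Hpp Hp' Hr Hr' Hs Hs' H.
destruct (spoke_range p r s) as (H1 & H2 & H3); [lia|exact Hr|exact Hs|].
destruct (spoke_range p' r' s') as (H4 & H5 & H6); [lia|exact Hr'|exact Hs'|].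
assert (H7 : (p * M + M <= p' * M)%nat) by nia.
apply le_INR in H7. rewrite plus_INR in H7. lra.
Qed.

(** The sign of [h] separates spokes, arms and the remaining edges. Radial edges and diagonals at
    equal height have equal parameters; then [u] is integral on a radial edge but not on a diagonal,
    and two diagonals that meet have indices less than 1 apart. *)
Lemma edges_disjoint e e' s s' : valid_edge e -> valid_edge e' -> open01 s -> open01 s' ->
  edge_u e s = edge_u e' s' -> edge_h e s = edge_h e' s' -> e = e'.
Proof.
intros He He' Hs Hs' Hu Hh. assert (HN := N_ge2). unfold open01 in Hs, Hs'.
destruct e as [k|k|k|p r], e' as [k'|k'|k'|p' r']; cbn in Hu, Hh; try nra.
- f_equal. apply INR_eq_of_close. lra.
- f_equal. apply INR_eq_of_close. lra.
- exfalso. destruct (al k').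
  + apply (INR_not_between k k' s'); lra.
  + apply (INR_not_between k k' (1 - s')); lra.
- exfalso. destruct (al k).
  + apply (INR_not_between k' k s); lra.
  + apply (INR_not_between k' k (1 - s)); lra.
- f_equal. apply INR_eq_of_close. destruct (al k), (al k'); lra.
- assert (s' = s) by lra. subst s'. cbn in He, He'.
  destruct (Nat.lt_total p p') as [H|[H|H]].
  + exfalso. apply (spokes_of_distinct_hubs p r p' r' s s); unfold closed01; lra || lia.
  + subst p'. f_equal. apply INR_eq. nra.
  + exfalso. apply (spokes_of_distinct_hubs p' r' p r s s); unfold closed01; lra || lia.
Qed.

Lemma spiral_periodic u h : spiral_x (u + N) h = spiral_x u (h + N) /\
  spiral_y (u + N) h = spiral_y u (h + N).
Proof.
assert (HN := N_ge2). unfold spiral_x, spiral_y.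
replace (2 * PI * (u + N) / N) with (2 * PI * u / N + 2 * PI) by (field; lra).
rewrite cos_plus, sin_plus, cos_2PI, sin_2PI. split; ring.
Qed.

Lemma edge_ends e : valid_edge e ->
  spiral_x (edge_u e 0) (edge_h e 0) = spiral_x (vertex_u (edge_src e)) (vertex_h (edge_src e)) /\
  spiral_y (edge_u e 0) (edge_h e 0) = spiral_y (vertex_u (edge_src e)) (vertex_h (edge_src e)) /\
  spiral_x (edge_u e 1) (edge_h e 1) = spiral_x (vertex_u (edge_tgt e)) (vertex_h (edge_tgt e)) /\
  spiral_y (edge_u e 1) (edge_h e 1) = spiral_y (vertex_u (edge_tgt e)) (vertex_h (edge_tgt e)).
Proof.
intros He.
assert (Hper : forall u, spiral_x u (0 + N * 1) = spiral_x (u + N) 0 /\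
                         spiral_y u (0 + N * 1) = spiral_y (u + N) 0).
{ intros u. destruct (spiral_periodic u 0) as [-> ->]. split; f_equal; ring. }
destruct e as [k|k|k|p r]; [| |destruct (al k) eqn:Ek|];
  cbn -[INR]; rewrite ?Ek; cbn -[INR]; rewrite ?S_INR, ?plus_INR, ?S_INR.
all: rewrite ?(proj1 (Hper _)), ?(proj2 (Hper _)).
5: cbn in He; destruct (lt_dec p t); [|lia].
all: repeat split; f_equal; try ring; try lra.
Qed.

(** Radial edges and diagonals end at height [N], outside [spiral_domain], so closed arcs need a
    separate argument: along one edge [u] varies by less than a full turn. *)
Lemma edge_inj e s s' : valid_edge e -> closed01 s -> closed01 s' ->
  spiral_x (edge_u e s) (edge_h e s) = spiral_x (edge_u e s') (edge_h e s') ->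
  spiral_y (edge_u e s) (edge_h e s) = spiral_y (edge_u e s') (edge_h e s') -> s = s'.
Proof.
intros He Hs Hs' Hx Hy. assert (HN := N_ge2).
assert (HMN : INR M < N) by (now apply lt_INR).
assert (Hpos : forall r, closed01 r -> 0 < edge_u e r + 1 + edge_h e r).
{ unfold closed01. intros r Hr.
  destruct e as [k|k|k|p q]; cbn.
  - assert (H := pos_INR k). lra.
  - assert (H := pos_INR k). nra.
  - assert (H := pos_INR k). destruct (al k); nra.
  - destruct He as [Hp Hq]. destruct (spoke_range p q r Hp Hq Hr) as (H1 & H2 & H3).
    assert (H4 := pos_INR (p * M)). lra. }
assert (Hd : - N < edge_u e s - edge_u e s' < N).
{ unfold closed01 in Hs, Hs'. destruct e as [k|k|k|p q]; cbn; try (destruct (al k)); try lra.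
  destruct He as [Hp Hq].
  destruct (spoke_range p q s Hp Hq Hs) as (H1 & H2 & H3).
  destruct (spoke_range p q s' Hp Hq Hs') as (H4 & H5 & H6). lra. }
destruct (spiral_coord_eq _ _ _ _ (Hpos s Hs) (Hpos s' Hs') Hx Hy) as [z [Hu Hh]].
assert (Hz : (z = 0)%Z).
{ assert (H1 : -1 < IZR z) by nra. assert (H2 : IZR z < 1) by nra.
  apply lt_IZR in H1. apply lt_IZR in H2. lia. }
subst z. destruct e as [k|k|k|p q]; cbn in Hu, Hh; try nra.
Qed.

Theorem spiral_planar : planar spiral_adj.
Proof.
apply (planar_of_edge_curves spiral_adj valid_edge edge_src edge_tgt
  (fun x => spiral_x (vertex_u x) (vertex_h x)) (fun x => spiral_y (vertex_u x) (vertex_h x))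
  (fun e s => spiral_x (edge_u e s) (edge_h e s)) (fun e s => spiral_y (edge_u e s) (edge_h e s))
  (arm 0)).
- now intros x y H.
- exact vertex_inj.
- assert (Hlin : forall a b c d,
    continuity (fun s => spiral_x (a + b * s) (c + d * s)) /\
    continuity (fun s => spiral_y (a + b * s) (c + d * s))).
  { intros a b c d. unfold spiral_x, spiral_y, Rdiv.
    split; apply derivable_continuous; reg. }
  intros [k|k|k|p r]; cbn; try destruct (al k); apply Hlin.
- exact edge_ends.
- exact edge_inj.
- intros e z s He Hs [Hx Hy].
  destruct (spiral_domain_inj _ _ _ _ (edge_domain e s He Hs) (vertex_domain z) Hx Hy).
  now apply (edge_avoids_vertex e z s).
- intros e e' s s' He He' Hs Hs' Hx Hy.
  destruct (spiral_domain_inj _ _ _ _ (edge_domain e s He Hs) (edge_domain e' s' He' Hs') Hx Hy).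
  now apply (edges_disjoint e e' s s').
Qed.
End Spiral.

(** * Leaving an embedded spiral *)

Section Host.
Local Open Scope nat_scope.
Context {U : Type} (adj : U -> U -> Prop) (adj_sym : forall x y, adj x y -> adj y x).
Context (n t : nat) (Hn : 6 <= n).

Lemma walk_app a l x l' b :
  walk adj a l x -> walk adj x l' b -> walk adj a (l ++ x :: l') b.
Proof.
revert a. induction l as [|y l IH]; cbn; intros a Hl Hl'; [tauto|].
destruct Hl as [H1 H2]. auto.
Qed.

(** Diagonals and spokes are kept apart: the former enter only by crossing, the latter only in the
    final assembly. The hubs are a parameter so that a second spiral can be compared with the hubs
    of the first. *)
Record spiral_in (g hub : nat -> U) : Prop := {
  spiral_injective : forall k k', g k = g k' -> k = k';
  spiral_arm : forall k, adj (g k) (g (S k));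
  spiral_radial : forall k, adj (g k) (g (k + n));
  spiral_not_hub : forall k p, p < t -> g k <> hub p
}.

Section Events.
Context (g hub : nat -> U).

(** [Z] collects vertices spent by earlier detours. Images of hubs with index at least [t] count as
    outside and may lie on a detour. *)
Definition outside (Z : list U) (v : U) : Prop :=
  (forall k, v <> g k) /\ (forall p, p < t -> v <> hub p) /\ ~ In v Z.

Definition ear (Z : list U) (a : nat) (P : list U) (b : nat) : Prop :=
  walk adj (g a) P (g b) /\ NoDup P /\ (forall v, In v P -> outside Z v).

(** Rays are the residue classes modulo [n]; the ear runs between two rays that are neither equal
    nor neighbours. The multiples [q1] and [q2] express the congruence without subtraction. *)
Definition chord (c : nat) (Z : list U) : Prop :=
  exists a b P e q1 q2, c <= a /\ c <= b /\ ear Z a P b /\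
    2 <= e /\ e + 2 <= n /\ b + q1 * n = a + e + q2 * n.

(* Two neighbouring rays exchange sides: [B] runs along the ray of [y0 + 1] but misses its vertex [y0 + n +
   1], which [A] reaches from the neighbouring ray; both may use further vertices of that ray. *)
Definition bypass (c : nat) (Z : list U) : Prop :=
  exists y0 q A B, c <= y0 /\ 1 <= q /\
    walk adj (g y0) A (g (y0 + n + 1)) /\
    walk adj (g (y0 + 1)) B (g (y0 + n + 1 + q * n)) /\
    NoDup (A ++ B) /\
    (forall v, In v (A ++ B) -> outside Z v \/ exists j, j <= q /\ v = g (y0 + n + j * n)).

Definition event (c : nat) (Z : list U) : Prop := chord c Z \/ bypass c Z.

Context (Hg : spiral_in g hub).

Lemma outside_not_spiral Z P k : (forall v, In v P -> outside Z v) -> ~ In (g k) P.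
Proof. intros H Hi. destruct (H _ Hi) as [H1 _]. now apply (H1 k). Qed.

(** The ears start at the two earlier neighbours of [y0 + n + 1]. With [d] the number of rays from
    that of [y0 + 1] to that of [x], one of the ears is a chord unless [x] lies on the ray of
    [y0 + 1] or of [y0]; these two cases give a bypass. *)
Lemma two_ears_event c Z y0 x P1 P2 : c <= y0 -> y0 + n + 1 < x ->
  ear Z (y0 + n) P1 x -> ear Z (y0 + 1) P2 x -> event c Z.
Proof.
intros Hc Hx HP1 HP2.
assert (Hmod := Nat.div_mod_eq (x - (y0 + 1)) n).
assert (Hlt : (x - (y0 + 1)) mod n < n) by (apply Nat.mod_upper_bound; lia).
set (d := (x - (y0 + 1)) mod n) in *. set (q := (x - (y0 + 1)) / n) in *.
assert (Hxq : x = y0 + 1 + d + q * n) by lia. clearbody d q. clear Hmod.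
destruct (Nat.eq_dec d 0) as [Hd|Hd]; [|destruct (Nat.eq_dec d 1) as [Hd1|Hd1];
  [|destruct (Nat.eq_dec d (n - 1)) as [Hd2|Hd2]]].
(* [x] is on the ray of [y0 + 1]: the second ear skips [y0 + n + 1], which is thus free for [A]. *)
- right. exists y0, (q - 1), [g (y0 + n)], P2.
  destruct HP2 as (W & ND & O).
  assert (2 <= q) by nia.
  replace (y0 + n + 1 + (q - 1) * n) with x by nia.
  split; [exact Hc|]. split; [lia|]. split.
  { cbn. split; [apply (spiral_radial _ _ Hg)|].
    rewrite Nat.add_1_r. apply (spiral_arm _ _ Hg). }
  split; [exact W|]. split.
  { cbn. constructor; [now apply (outside_not_spiral Z)|exact ND]. }
  intros v [<-|Hv]; [right; exists 0; split; [lia|f_equal; lia]|left; auto].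
- left. exists (y0 + n), x, P1, 2, 1, q. split; [lia|]. split; [lia|]. split; [exact HP1|lia].
(* [x] is on the ray of [y0]: one arm step past [x] brings [B] back to the ray of [y0 + 1]. *)
- right. exists y0, q, [g (y0 + n)], (P2 ++ [g x]).
  destruct HP2 as (W & ND & O).
  assert (1 <= q) by nia.
  replace (y0 + n + 1 + q * n) with (S x) by lia.
  split; [exact Hc|]. split; [lia|]. split.
  { cbn. split; [apply (spiral_radial _ _ Hg)|].
    rewrite Nat.add_1_r. apply (spiral_arm _ _ Hg). }
  split; [apply walk_app; [exact W|apply (spiral_arm _ _ Hg)]|]. split.
  { cbn. constructor.
    - intros Hi. apply in_app_or in Hi. destruct Hi as [Hi|[Hi|[]]].
      + now apply (outside_not_spiral Z P2 (y0 + n)).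
      + apply (spiral_injective _ _ Hg) in Hi. nia.
    - apply NoDup_app; [exact ND|repeat constructor; tauto|].
      intros v Hv [<-|[]]. now apply (outside_not_spiral Z P2 x). }
  intros v Hv. cbn in Hv. destruct Hv as [<-|Hv].
  { right. exists 0. split; [lia|f_equal; lia]. }
  apply in_app_or in Hv. destruct Hv as [Hv|[<-|[]]]; [left; auto|].
  right. exists q. split; [lia|f_equal; nia].
- left. exists (y0 + 1), x, P2, d, 0, q. split; [lia|]. split; [lia|]. split; [exact HP2|lia].
Qed.

Context (f : nat -> U) (Hf : spiral_in f hub).

(* [f] cannot step off [g] at [y] without crossing it: otherwise [f y] lies outside, then so do [f (y+n)],
   ..., [f (y+n+2)] and [f (y+2)], because [g y] is the only later vertex of [g] that an ear from both
   neighbours of [y] may reach, and it is taken by [f (y+1)]. *)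
Lemma first_disagreement_event c Z y0 : c <= y0 ->
  (forall k, k < y0 + n + 1 -> f k = g k) ->
  f (y0 + n + 1) <> g (y0 + n + 1) ->
  (forall k, c <= k -> ~ In (f k) Z) ->
  event c Z.
Proof.
intros Hc Heq Hne HZ. set (y := y0 + n + 1) in *.
assert (Hcases : forall k, y <= k -> (exists x, y <= x /\ f k = g x) \/ outside Z (f k)).
{ intros k Hk. destruct (classic (exists x, f k = g x)) as [[x Hx]|H].
  - left. exists x. split; [|exact Hx].
    destruct (le_lt_dec y x) as [|Hlt]; [assumption|].
    rewrite <- (Heq x Hlt) in Hx. apply (spiral_injective _ _ Hf) in Hx. lia.
  - right. split; [|split].
    + intros x Hx. apply H. eauto.
    + intros p Hp. now apply (spiral_not_hub _ _ Hf).
    + apply HZ. lia. }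
(* A walk through outside vertices, attached to both earlier neighbours of [y], becomes two ears as
   soon as it meets a later vertex of [g] other than [g y]. *)
assert (Hreach : forall k P, y <= k -> NoDup P -> (forall v, In v P -> outside Z v) ->
   walk adj (g (y0 + n)) P (f k) -> walk adj (g (y0 + 1)) P (f k) ->
   f k = g y \/ outside Z (f k) \/ event c Z).
{ intros k P Hk HND HO W1 W2. destruct (Hcases k Hk) as [[x [Hx Hfx]]|H]; [|tauto].
  destruct (Nat.eq_dec x y) as [->|Hxy]; [tauto|]. right. right.
  rewrite Hfx in W1, W2.
  apply (two_ears_event c Z y0 x P P); [exact Hc|lia| |]; split; auto. }
assert (A1 : adj (g (y0 + n)) (f y)).
{ rewrite <- Heq by lia. unfold y. rewrite Nat.add_1_r. apply (spiral_arm _ _ Hf). }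
assert (A2 : adj (g (y0 + 1)) (f y)).
{ rewrite <- Heq by lia. replace y with (y0 + 1 + n) by lia. apply (spiral_radial _ _ Hf). }
assert (B0 : adj (f y) (f (y + 1))) by (rewrite Nat.add_1_r; apply (spiral_arm _ _ Hf)).
assert (B1 : adj (f y) (f (y + n))) by apply (spiral_radial _ _ Hf).
assert (B2 : adj (f (y + n)) (f (y + n + 1))) by (rewrite Nat.add_1_r; apply (spiral_arm _ _ Hf)).
assert (B3 : adj (f (y + n + 1)) (f (y + n + 2))).
{ replace (y + n + 2) with (S (y + n + 1)) by lia. apply (spiral_arm _ _ Hf). }
assert (B4 : adj (f (y + n + 2)) (f (y + 2))).
{ apply adj_sym. replace (y + n + 2) with (y + 2 + n) by lia. apply (spiral_radial _ _ Hf). }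
assert (C1 : adj (f (y + 1)) (g (y0 + 2))).
{ apply adj_sym. rewrite <- (Heq (y0 + 2)) by lia.
  replace (y + 1) with (y0 + 2 + n) by lia. apply (spiral_radial _ _ Hf). }
assert (C2 : adj (f (y + 2)) (g (y0 + 3))).
{ apply adj_sym. rewrite <- (Heq (y0 + 3)) by lia.
  replace (y + 2) with (y0 + 3 + n) by lia. apply (spiral_radial _ _ Hf). }
assert (Hinj := spiral_injective _ _ Hf).
assert (HND : forall l, NoDup l -> NoDup (map f l)).
{ intros l Hl. now apply Injective_map_NoDup. }
assert (Hout : forall l, Forall (fun k => outside Z (f k)) l ->
   forall v, In v (map f l) -> outside Z v).
{ intros l Hl v Hv. apply in_map_iff in Hv. destruct Hv as [k [<- Hk]].
  rewrite Forall_forall in Hl. auto. }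
assert (Hnd1 : NoDup [y]) by (repeat constructor; cbn; lia).
assert (Hnd1' : NoDup [y; y + 1]) by (repeat constructor; cbn; lia).
assert (Hnd2 : NoDup [y; y + n]) by (repeat constructor; cbn; lia).
assert (Hnd3 : NoDup [y; y + n; y + n + 1]) by (repeat constructor; cbn; lia).
assert (Hnd4 : NoDup [y; y + n; y + n + 1; y + n + 2]) by (repeat constructor; cbn; lia).
assert (Hnd5 : NoDup [y; y + n; y + n + 1; y + n + 2; y + 2]) by (repeat constructor; cbn; lia).
apply HND in Hnd1, Hnd1', Hnd2, Hnd3, Hnd4, Hnd5. cbn [map] in *.
destruct (Hreach y [] (le_n _)) as [|[O1|]]; cbn; try tauto; [constructor|].
assert (O1' : forall v, In v [f y] -> outside Z v) by (apply (Hout [y]); auto).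
destruct (Hreach (y + 1) [f y]) as [E|[O|]]; cbn; auto; try lia.
(* If [f (y + 1)] is outside as well, the radial step back to [g (y0 + 2)] closes a chord across two
   rays. *)
2:{ left. exists (y0 + n), (y0 + 2), [f y; f (y + 1)], 2, 1, 0.
  split; [lia|]. split; [lia|].
  split; [|lia]. split; [cbn; auto|]. split; [auto|]. apply (Hout [y; y + 1]); auto. }
(* Now [f (y + 1)] occupies [g y], so the walk round it, one turn further out, stays outside until
   it comes back at [g (y0 + 3)]: a chord across three rays. *)
assert (Hnot : forall k, k <> y + 1 -> f k <> g y).
{ intros k Hk Hk'. rewrite <- E in Hk'. apply Hinj in Hk'. lia. }
destruct (Hreach (y + n) [f y]) as [E1|[O2|]]; cbn; auto; try lia.
{ exfalso. apply (Hnot (y + n)); [lia|auto]. }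
destruct (Hreach (y + n + 1) [f y; f (y + n)]) as [E1|[O3|]]; cbn; auto; try lia.
{ apply (Hout [y; y + n]). auto. }
{ exfalso. apply (Hnot (y + n + 1)); [lia|auto]. }
destruct (Hreach (y + n + 2) [f y; f (y + n); f (y + n + 1)]) as [E1|[O4|]];
  cbn -[Nat.add]; auto 6; try lia.
{ apply (Hout [y; y + n; y + n + 1]). auto. }
{ exfalso. apply (Hnot (y + n + 2)); [lia|auto]. }
destruct (Hreach (y + 2) [f y; f (y + n); f (y + n + 1); f (y + n + 2)]) as [E1|[O5|]];
  cbn -[Nat.add]; auto 7; try lia.
{ apply (Hout [y; y + n; y + n + 1; y + n + 2]). auto. }
{ exfalso. apply (Hnot (y + 2)); [lia|auto]. }
left. exists (y0 + n), (y0 + 3), [f y; f (y + n); f (y + n + 1); f (y + n + 2); f (y + 2)], 3, 1, 0.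
split; [lia|]. split; [lia|]. split; [|lia].
split; [cbn -[Nat.add]; auto 8|]. split; [auto|].
apply (Hout [y; y + n; y + n + 1; y + n + 2; y + 2]); auto 6.
Qed.

(** One diagonal is all of [A]. The other takes [B] to the ray of [k], on which it passes the end of
    [A] before an arm edge leads it back. *)
Lemma crossing_diagonals_event c Z k : c <= k ->
  adj (g k) (g (S k + n)) -> adj (g (S k)) (g (k + n)) -> event c Z.
Proof.
intros Hc D1 D2. right. exists k, 1, [], [g (k + n); g (k + n + n)].
assert (Hinj := spiral_injective _ _ Hg).
split; [exact Hc|]. split; [lia|]. split; [|split; [|split]].
- cbn. replace (k + n + 1) with (S k + n) by lia. exact D1.
- cbn -[Nat.add]. replace (k + 1) with (S k) by lia.
  replace (k + n + 1 + (n + 0)) with (S (k + n + n)) by lia.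
  split; [exact D2|]. split; [apply (spiral_radial _ _ Hg)|apply (spiral_arm _ _ Hg)].
- cbn. repeat constructor; cbn; try tauto. intros [H|[]]. apply Hinj in H. lia.
- intros v [<-|[<-|[]]]; right; [exists 0|exists 1]; split; try lia; f_equal; lia.
Qed.
End Events.

(** * Counting codes against a countable host *)

Lemma injective_leaves_list (f : nat -> U) (Z : list U) :
  (forall k k', f k = f k' -> k = k') -> exists c, forall k, c <= k -> ~ In (f k) Z.
Proof.
intros Hinj. induction Z as [|z Z [c IH]]; [exists 0; cbn; tauto|].
destruct (classic (exists j, f j = z)) as [[j Hj]|H].
- exists (c + S j). intros k Hk [Hz|Hz].
  + rewrite <- Hj in Hz. apply Hinj in Hz. lia.
  + apply (IH k); [lia|exact Hz].
- exists c. intros k Hk [Hz|Hz]; [apply H; eauto|now apply (IH k)].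
Qed.

Fixpoint encode (l : list nat) : nat :=
  match l with
  | [] => 0
  | x :: l' => S (to_nat (x, encode l'))
  end.

Lemma encode_inj l l' : encode l = encode l' -> l = l'.
Proof.
revert l'. induction l as [|x l IH]; intros [|x' l']; cbn -[to_nat]; try discriminate; auto.
intros H. apply Nat.succ_inj, to_nat_inj in H. injection H as -> H. now rewrite (IH _ H).
Qed.

(** Cantor's diagonal argument: [d] differs from each sequence at the value of its own code. *)
Lemma no_injective_code (F : (nat -> bool) -> nat) :
  exists a b, F a = F b /\ exists k, a k <> b k.
Proof.
apply NNPP. intros Hno.
assert (Hinj : forall a b, F a = F b -> forall k, a k = b k).
{ intros a b H k. apply NNPP. intros Hk. apply Hno. exists a, b. eauto. }
pose (d := fun m => match excluded_middle_informative (exists a, F a = m) with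
  | left H => negb (proj1_sig (constructive_indefinite_description _ H) m)
  | right _ => true
  end).
assert (Hd : d (F d) = negb (d (F d))); [|destruct (d (F d)); discriminate].
unfold d at 1. destruct (excluded_middle_informative _) as [H|H].
- destruct (constructive_indefinite_description _ H) as [a Ha]. cbn. f_equal.
  now apply Hinj.
- exfalso. apply H. now exists d.
Qed.

Lemma least_witness (P : nat -> Prop) :
  (exists k, P k) -> exists k, P k /\ forall j, j < k -> ~ P j.
Proof.
intros [k Hk]. induction k as [k IH] using (well_founded_induction lt_wf).
destruct (classic (exists j, j < k /\ P j)) as [[j [Hj HP]]|H].
- exact (IH j Hj HP).
- exists k. split; [exact Hk|]. intros j Hj HP. apply H. eauto.
Qed.

(* If no member of the uncountable family had this property, each would be tame beyond some [c] and [Z]; two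
   members with the same finite data up to [c] would then cross. *)
Lemma exists_spiral_with_events (code : U -> nat)
  (F Hub : (nat -> bool) -> nat -> U) :
  (forall x y, code x = code y -> x = y) ->
  (forall al, spiral_in (F al) (Hub al)) ->
  (forall al k, if al k : bool then adj (F al k) (F al (S k + n))
                else adj (F al (S k)) (F al (k + n))) ->
  exists al, forall c Z, event (F al) (Hub al) c Z.
Proof.
intros Hcode HF Hdiag. apply NNPP. intros Hno.
assert (Htame : forall al, exists cZ : nat * list U,
  ~ event (F al) (Hub al) (fst cZ) (snd cZ) /\
  forall k, fst cZ <= k -> ~ In (F al k) (snd cZ)).
{ intros al. apply NNPP. intros H. apply Hno. exists al. intros c Z. apply NNPP. intros He.
  (* An event at a larger [c] is also one at a smaller [c], so [c] can be raised until the spiral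
     avoids [Z] without creating events. *)
  destruct (injective_leaves_list (F al) Z (spiral_injective _ _ (HF al))) as [c' Hc'].
  apply H. exists (c + c', Z). cbn. split.
  - intros [(a & b & P & e & q1 & q2 & H1 & H2 & H3)|(y0 & q & A & B & H1 & H2)].
    + apply He. left. exists a, b, P, e, q1, q2. repeat (split; [lia|]). exact H3.
    + apply He. right. exists y0, q, A, B. split; [lia|]. exact H2.
  - intros k Hk. apply Hc'. lia. }
pose (tm al := proj1_sig (constructive_indefinite_description _ (Htame al))).
assert (Htm : forall al, ~ event (F al) (Hub al) (fst (tm al)) (snd (tm al)) /\
  forall k, fst (tm al) <= k -> ~ In (F al k) (snd (tm al))).
{ intros al. exact (proj2_sig (constructive_indefinite_description _ (Htame al))). }
clearbody tm. clear Htame Hno.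
(* The additional [n + 1] vertices ensure that a first disagreement at [y] leaves [y0 = y - (n + 1)]
   at or beyond [c]. *)
pose (width al := fst (tm al) + n + 1).
(* [Z] and the hubs belong to the common data because the second spiral must avoid those of the
   first one. *)
destruct (no_injective_code (fun al => encode
  [fst (tm al); encode (map code (snd (tm al)));
   encode (map (fun k => code (F al k)) (seq 0 (width al)));
   encode (map (fun p => code (Hub al p)) (seq 0 t));
   encode (map (fun k => Nat.b2n (al k)) (seq 0 (width al)))])) as (a & b & Hab & k & Hk).
apply encode_inj in Hab. injection Hab as Hc HZ HFab Hhub Hal.
apply encode_inj in HZ, HFab, Hhub, Hal.
assert (HZ' : snd (tm a) = snd (tm b)).
{ clear - HZ Hcode. revert HZ. generalize (snd (tm b)).
  induction (snd (tm a)) as [|x l IH]; intros [|y l']; cbn; try discriminate; auto.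
  intros H. injection H as H1 H2. f_equal; auto. }
assert (Hw : width b = width a) by (unfold width; lia).
rewrite Hw in HFab, Hal.
assert (HFk : forall j, j < width a -> F b j = F a j).
{ intros j Hj. symmetry. apply Hcode.
  apply (ext_in_map HFab j). apply in_seq. lia. }
assert (Halk : forall j, j < width a -> a j = b j).
{ intros j Hj. apply Nat.b2n_inj. apply (ext_in_map Hal j). apply in_seq. lia. }
assert (Hhubs : forall p, p < t -> Hub b p = Hub a p).
{ intros p Hp. symmetry. apply Hcode. apply (ext_in_map Hhub p). apply in_seq. lia. }
assert (Hb : spiral_in (F b) (Hub a)).
{ destruct (HF b) as [H1 H2 H3 H4]. split; auto.
  intros j p Hp. rewrite <- Hhubs by exact Hp. auto. }
destruct (Htm a) as [Hna _]. apply Hna. unfold width in *.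
destruct (classic (exists j, F b j <> F a j)) as [Hex|Hall].
- destruct (least_witness _ Hex) as [y [Hy Hmin]].
  assert (Hyw : fst (tm a) + n + 1 <= y).
  { destruct (le_lt_dec (fst (tm a) + n + 1) y); [assumption|].
    exfalso. apply Hy, HFk. assumption. }
  assert (Ey : y - (n + 1) + n + 1 = y) by lia.
  apply (first_disagreement_event _ _ (HF a) (F b) Hb _ _ (y - (n + 1))); try rewrite Ey; auto.
  + lia.
  + intros j Hj. apply NNPP. now apply Hmin.
  + intros j Hj. rewrite HZ'. apply (Htm b). lia.
- assert (Heq : forall j, F b j = F a j).
  { intros j. apply NNPP. intros H. apply Hall. eauto. }
  assert (Hkw : fst (tm a) <= k).
  { destruct (le_lt_dec (fst (tm a) + n + 1) k); [lia|]. exfalso. apply Hk, Halk. assumption. }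
  assert (Da := Hdiag a k). assert (Db := Hdiag b k). rewrite !Heq in Db.
  destruct (a k), (b k); try congruence;
    now apply (crossing_diagonals_event _ _ (HF a) _ _ k).
Qed.
End Host.

(** * Routing tokens along the rays *)

Section Chains.
Context {U : Type} (adj : U -> U -> Prop) (adj_sym : forall x y, adj x y -> adj y x).

Fixpoint chain (l : list U) : Prop :=
  match l with
  | [] => True
  | x :: l' => match l' with [] => True | y :: _ => adj x y end /\ chain l'
  end.

Lemma chain_app l x l' : chain (l ++ x :: l') <-> chain (l ++ [x]) /\ chain (x :: l').
Proof.
induction l as [|y l IH]; [cbn; tauto|].
cbn [app chain]. rewrite IH. destruct l; cbn; tauto.
Qed.

Lemma chain_rev l : chain l -> chain (rev l).
Proof.
induction l as [|x l IH]; [auto|]. intros H. cbn [rev].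
destruct l as [|y l]; [cbn; auto|].
destruct H as [H1 H2]. cbn [rev] in *. rewrite <- app_assoc. cbn.
apply chain_app. split; [auto|]. cbn. auto.
Qed.

(* A path from [a] to [b], listing [a] but not [b]; empty when [a = b]. *)
Definition leads (a : U) (s : list U) (b : U) : Prop :=
  chain (s ++ [b]) /\ hd_error (s ++ [b]) = Some a.

Definition joins (a : U) (l : list U) (b : U) : Prop :=
  chain l /\ hd_error l = Some a /\ hd_error (rev l) = Some b.

Lemma hd_error_app (l l' : list U) a : hd_error l' = Some a ->
  hd_error (l ++ l') = hd_error (l ++ [a]).
Proof. destruct l; cbn; auto. Qed.

Lemma leads_app a s b s' c : leads a s b -> leads b s' c -> leads a (s ++ s') c.
Proof.
intros [C1 H1] [C2 H2]. unfold leads. rewrite <- app_assoc. split.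
- destruct (s' ++ [c]) as [|x l]; [discriminate|]. injection H2 as ->.
  now apply chain_app.
- now rewrite (hd_error_app _ _ b).
Qed.

Lemma leads_one a b : adj a b -> leads a [a] b.
Proof. intros H. split; cbn; auto. Qed.

Lemma leads_nil a : leads a [] a.
Proof. split; cbn; auto. Qed.

Lemma leads_walk a l b : walk adj a l b -> leads a (a :: l) b.
Proof.
split; [|reflexivity]. revert a H. induction l as [|x l IH]; intros a; cbn; [auto|].
intros [H1 H2]. split; [exact H1|]. now apply IH.
Qed.

Lemma joins_extend a s a' l b' s' b :
  leads a s a' -> joins a' l b' -> leads b s' b' -> joins a (s ++ l ++ rev s') b.
Proof.
intros [C1 H1] (C2 & H2 & H3) [C4 H4].
destruct l as [|x l1]; [discriminate|]. injection H2 as ->.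
assert (Hl : exists l2, a' :: l1 = l2 ++ [b']).
{ exists (rev (tl (rev (a' :: l1)))). rewrite <- (rev_involutive (a' :: l1)) at 1.
  destruct (rev (a' :: l1)) as [|y l3]; [discriminate|]. injection H3 as ->. reflexivity. }
split; [|split].
- assert (C5 : chain (s ++ a' :: l1)) by (apply chain_app; auto).
  destruct Hl as [l2 Hl]. rewrite Hl in *.
  rewrite <- app_assoc, app_assoc. cbn. apply chain_app. split.
  + now rewrite <- app_assoc.
  + apply chain_rev in C4. rewrite rev_app_distr in C4. exact C4.
- cbn. now rewrite (hd_error_app _ _ a').
- rewrite !rev_app_distr, rev_involutive, <- app_assoc.
  rewrite (hd_error_app _ _ b'); [exact H4|].
  destruct (rev (a' :: l1)); [discriminate|exact H3].
Qed.

Lemma walk_rev a l b : walk adj a l b -> walk adj b (rev l) a.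
Proof.
revert a. induction l as [|x l IH]; cbn; intros a; [auto|].
intros [H1 H2]. apply (walk_app adj b (rev l) x [] a); cbn; auto.
Qed.

Lemma joins_walk a l b x y :
  adj x a -> adj b y -> joins a l b -> walk adj x l y.
Proof.
intros Hx Hy (C & H1 & H2).
destruct l as [|a' l]; [discriminate|]. injection H1 as ->.
split; [exact Hx|].
clear Hx. revert a C H2. induction l as [|z l IH]; intros a C H2.
- cbn in *. congruence.
- cbn. split; [apply C|]. apply IH; [apply C|].
  cbn [rev] in *. destruct (rev l); cbn in *; auto.
Qed.
End Chains.

(** * Ranks of tokens in a list *)

Fixpoint index (L : list nat) (x : nat) : nat :=
  match L with
  | [] => 0
  | y :: L' => if Nat.eq_dec y x then 0 else S (index L' x)
  end.

Section Index.
Local Open Scope nat_scope.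

Lemma index_lt L x : In x L -> index L x < length L.
Proof.
induction L as [|y L IH]; cbn; [tauto|]. intros [->|H].
- destruct (Nat.eq_dec x x); [lia|congruence].
- destruct (Nat.eq_dec y x); [lia|]. specialize (IH H). lia.
Qed.

Lemma index_nth L k d : NoDup L -> k < length L -> index L (nth k L d) = k.
Proof.
intros H. revert k. induction H as [|x L Hx HL IH]; cbn; [lia|].
intros [|k] Hk; cbn.
- destruct (Nat.eq_dec x x); congruence.
- destruct (Nat.eq_dec x (nth k L d)) as [E|E].
  + exfalso. apply Hx. rewrite E. apply nth_In. lia.
  + rewrite IH; lia.
Qed.

Lemma nth_index L x d : In x L -> nth (index L x) L d = x.
Proof.
induction L as [|y L IH]; cbn; [tauto|]. intros [->|H].
- destruct (Nat.eq_dec x x); [reflexivity|congruence].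
- destruct (Nat.eq_dec y x); auto.
Qed.

Lemma index_inj L x y : In x L -> In y L -> index L x = index L y -> x = y.
Proof.
intros Hx Hy H. rewrite <- (nth_index L x 0 Hx), H. now apply nth_index.
Qed.

Lemma index_app_l L L' x : In x L -> index (L ++ L') x = index L x.
Proof.
induction L as [|y L IH]; cbn; [tauto|]. intros [->|H].
- destruct (Nat.eq_dec x x); [reflexivity|congruence].
- destruct (Nat.eq_dec y x); auto.
Qed.

Lemma index_app_r L L' x : ~ In x L -> index (L ++ L') x = length L + index L' x.
Proof.
induction L as [|y L IH]; cbn; [auto|]. intros H.
destruct (Nat.eq_dec y x) as [->|_]; [tauto|]. rewrite IH; tauto.
Qed.
Lemma index_filter_seq f a m x y :
  In x (filter f (seq a m)) -> In y (filter f (seq a m)) ->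
  index (filter f (seq a m)) x < index (filter f (seq a m)) y -> x < y.
Proof.
revert a. induction m as [|m IH]; intros a; cbn; [tauto|].
assert (Hgt : forall z, In z (filter f (seq (S a) m)) -> a < z).
{ intros z Hz. apply filter_In in Hz. destruct Hz as [Hz _]. apply in_seq in Hz. lia. }
destruct (f a); [|apply IH].
intros [<-|Hx] [<-|Hy]; cbn.
- lia.
- intros _. now apply Hgt.
- destruct (Nat.eq_dec a a); [lia|congruence].
- assert (H1 := Hgt x Hx). assert (H2 := Hgt y Hy).
  destruct (Nat.eq_dec a x); [lia|]. destruct (Nat.eq_dec a y); [lia|].
  intros H. apply (IH (S a)); auto. lia.
Qed.
End Index.

(** * Linkages, and their extension by outward moves of the tokens *)

Section Routing.
Local Open Scope nat_scope.
Context {U : Type} (adj : U -> U -> Prop) (adj_sym : forall x y, adj x y -> adj y x).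
Context (n t : nat) (Hn : 6 <= n) (g hub : nat -> U) (Hg : spiral_in adj n t g hub).
Context (pi : nat -> nat) (pi_invol : forall x, pi (pi x) = x).

Local Notation outside := (outside t g hub).
Local Notation event := (event adj n t g hub).
Local Notation leads := (leads adj).
Local Notation joins := (joins adj).

Definition allowed (c : nat) (Z : list U) (v : U) : Prop :=
  (exists k, c <= k /\ v = g k) \/ outside Z v.

Definition paired (L : list nat) : Prop :=
  NoDup L /\ (forall x, In x L -> In (pi x) L) /\ (forall x, In x L -> pi x <> x).

(** A path is indexed by either of its ends, so disjointness is asked only of paths that belong to
    different pairs. *)
Definition linkable (c : nat) (Z : list U) (L : list nat) (pos : nat -> nat) : Prop :=
  exists P : nat -> list U,
    (forall x, In x L -> joins (g (pos x)) (P x) (g (pos (pi x)))) /\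
    (forall x, In x L -> NoDup (P x)) /\
    (forall x v, In x L -> In v (P x) -> allowed c Z v) /\
    (forall x y v, In x L -> In y L -> y <> x -> y <> pi x -> In v (P x) -> ~ In v (P y)).

Lemma linkable_same c Z L L' pos pos' :
  (forall x, In x L <-> In x L') -> paired L -> (forall x, In x L -> pos x = pos' x) ->
  linkable c Z L' pos' -> linkable c Z L pos.
Proof.
intros HL (_ & Hpi & _) Hpos (P & H1 & H2 & H3 & H4). exists P.
split; [|split; [|split]].
- intros x Hx. rewrite !Hpos by auto. apply H1. now apply HL.
- intros x Hx. apply H2. now apply HL.
- intros x v Hx. apply H3. now apply HL.
- intros x y v Hx Hy. apply H4; now apply HL.
Qed.

(** All routing goes through this step. Moves spend only spiral vertices before [c'] and outside
    vertices recorded in [Z'], neither of which a later path may use; the piece of [x] is put before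
    its path and that of [pi x], reversed, after it. *)
Lemma linkable_prepend c Z c' Z' L pos pos' s :
  paired L -> c <= c' -> (forall v, In v Z -> In v Z') ->
  (forall x, In x L -> leads (g (pos x)) (s x) (g (pos' x))) ->
  (forall x, In x L -> NoDup (s x)) ->
  (forall x v, In x L -> In v (s x) ->
     (exists k, c <= k /\ k < c' /\ v = g k) \/ (outside Z v /\ In v Z')) ->
  (forall x y v, In x L -> In y L -> x <> y -> In v (s x) -> ~ In v (s y)) ->
  linkable c' Z' L pos' -> linkable c Z L pos.
Proof.
intros (_ & Hpi & Hfix) Hc HZ S1 S2 S3 S4 (P & P1 & P2 & P3 & P4).
exists (fun x => s x ++ P x ++ rev (s (pi x))).
assert (Hsep : forall x y v, In x L -> In y L -> In v (s x) -> ~ In v (P y)).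
{ intros x y v Hx Hy Hv Hv'. specialize (P3 y v Hy Hv').
  destruct (S3 x v Hx Hv) as [(k & K1 & K2 & ->)|[O I]].
  - destruct P3 as [(k' & K3 & K4)|[O _]].
    + apply (spiral_injective _ _ _ _ _ Hg) in K4. lia.
    + now apply (O k).
  - destruct P3 as [(k' & K3 & ->)|[_ [_ O']]].
    + now apply (proj1 O k').
    + tauto. }
assert (Hin : forall x v, In v (s x ++ P x ++ rev (s (pi x))) <->
   In v (s x) \/ In v (P x) \/ In v (s (pi x))).
{ intros x v. rewrite !in_app_iff, <- in_rev. tauto. }
split; [|split; [|split]].
- intros x Hx. apply (joins_extend adj adj_sym _ _ (g (pos' x)) _ (g (pos' (pi x)))); auto.
- intros x Hx. apply NoDup_app; [auto| |].
  + apply NoDup_app; [auto|apply NoDup_rev; auto|].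
    intros v Hv Hv'. apply in_rev in Hv'. now apply (Hsep (pi x) x v); auto.
  + intros v Hv Hv'. rewrite in_app_iff, <- in_rev in Hv'. destruct Hv' as [Hv'|Hv'].
    * now apply (Hsep x x v).
    * apply (S4 x (pi x) v); auto. intros E. symmetry in E. now apply (Hfix x).
- intros x v Hx Hv. apply Hin in Hv.
  assert (Hs : forall y, In y L -> In v (s y) -> allowed c Z v).
  { intros y Hy Hvy. destruct (S3 y v Hy Hvy) as [(k & K1 & K2 & ->)|[O I]].
    - left. eauto.
    - right. exact O. }
  destruct Hv as [Hv|[Hv|Hv]]; eauto.
  destruct (P3 x v Hx Hv) as [(k & K1 & ->)|(O1 & O2 & O3)].
  + left. exists k. split; [lia|reflexivity].
  + right. split; [|split]; auto.
- intros x y v Hx Hy N1 N2 Hv Hv'. apply Hin in Hv, Hv'.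
  assert (N3 : pi y <> pi x) by (intros E; apply N1; rewrite <- (pi_invol y), E; apply pi_invol).
  assert (N4 : x <> pi y) by (intros E; apply N2; rewrite E; now rewrite pi_invol).
  destruct Hv as [Hv|[Hv|Hv]], Hv' as [Hv'|[Hv'|Hv']].
  + apply (S4 x y v); auto.
  + apply (Hsep x y v); auto.
  + apply (S4 x (pi y) v); auto.
  + apply (Hsep y x v); auto.
  + apply (P4 x y v); auto.
  + apply (Hsep (pi y) x v); auto.
  + apply (S4 (pi x) y v); auto.
  + apply (Hsep (pi x) y v); auto.
  + apply (S4 (pi x) (pi y) v); auto.
Qed.

Lemma linkable_later c c' Z L pos : paired L -> c <= c' ->
  linkable c' Z L pos -> linkable c Z L pos.
Proof.
intros HL Hc. apply (linkable_prepend _ _ _ _ _ _ _ (fun _ => [])); auto.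
- intros. apply leads_nil.
- intros. constructor.
- intros x v _ [].
Qed.

(** A window is one full turn and so meets every ray once; the list records the order of the tokens
    from the start of the window. *)
Definition placed (c : nat) (L : list nat) (pos : nat -> nat) : Prop :=
  (forall x, In x L -> c <= pos x /\ pos x < c + n) /\
  (forall x y, In x L -> In y L -> index L x < index L y -> pos x < pos y).

Lemma placed_inj c L pos x y : placed c L pos -> In x L -> In y L -> pos x = pos y -> x = y.
Proof.
intros [_ H] Hx Hy E. apply (index_inj L); auto.
destruct (Nat.lt_total (index L x) (index L y)) as [H1|[H1|H1]]; [|exact H1|].
- specialize (H x y Hx Hy H1). lia.
- specialize (H y x Hy Hx H1). lia.
Qed.

(** [x] counts rays and [a] counts turns, both from the vertex [c]. *)
Definition lane (c x a : nat) : U := g (c + (x + a * n)).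

Lemma row_unique x a y b : x < n -> y < n -> x + a * n = y + b * n -> x = y /\ a = b.
Proof.
intros Hx Hy H. assert (a = b); [|subst; lia].
destruct (Nat.lt_total a b) as [H1|[H1|H1]]; nia.
Qed.

Lemma lane_inj c x a y b : x < n -> y < n -> lane c x a = lane c y b -> x = y /\ a = b.
Proof.
intros Hx Hy H. apply (spiral_injective _ _ _ _ _ Hg) in H. apply row_unique; lia.
Qed.

Fixpoint strip (c x a q : nat) : list U :=
  match q with
  | 0 => []
  | S q' => lane c x a :: strip c x (S a) q'
  end.

Lemma lane_radial c x a : adj (lane c x a) (lane c x (S a)).
Proof.
unfold lane. replace (c + (x + S a * n)) with (c + (x + a * n) + n) by lia.
apply (spiral_radial _ _ _ _ _ Hg).
Qed.

Lemma strip_leads c x a q : leads (lane c x a) (strip c x a q) (lane c x (a + q)).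
Proof.
revert a. induction q as [|q IH]; intros a; cbn [strip].
- rewrite Nat.add_0_r. apply leads_nil.
- replace (a + S q) with (S a + q) by lia.
  apply (leads_app adj _ [_] (lane c x (S a))); [|apply IH].
  apply leads_one, lane_radial.
Qed.

Lemma in_strip c x a q v : In v (strip c x a q) <-> exists j, a <= j /\ j < a + q /\ v = lane c x j.
Proof.
revert a. induction q as [|q IH]; intros a; cbn.
- split; [tauto|]. intros (j & H1 & H2 & _). lia.
- rewrite IH. split.
  + intros [<-|(j & H1 & H2 & H3)]; [exists a|exists j]; repeat split; auto; lia.
  + intros (j & H1 & H2 & H3). destruct (Nat.eq_dec a j) as [->|]; [auto|right].
    exists j. repeat split; auto; lia.
Qed.

Lemma strip_nodup c x a q : x < n -> NoDup (strip c x a q).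
Proof.
intros Hx. revert a. induction q as [|q IH]; intros a; cbn; constructor; auto.
rewrite in_strip. intros (j & H1 & H2 & H3). apply lane_inj in H3; lia.
Qed.

Lemma lane_pos c p : c <= p -> g p = lane c (p - c) 0.
Proof. intros H. unfold lane. f_equal. lia. Qed.

Lemma linkable_straight c Z L pos q : paired L -> placed c L pos ->
  linkable (c + q * n) Z L (fun x => pos x + q * n) -> linkable c Z L pos.
Proof.
intros HL Hp. destruct (Hp) as [Hw _].
apply (linkable_prepend _ _ _ _ _ _ _ (fun x => strip c (pos x - c) 0 q)); auto; [lia| | | |].
- intros x Hx. specialize (Hw x Hx). rewrite (lane_pos c) by lia.
  replace (g (pos x + q * n)) with (lane c (pos x - c) (0 + q)) by (unfold lane; f_equal; lia).
  apply strip_leads.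
- intros x Hx. specialize (Hw x Hx). apply strip_nodup. lia.
- intros x v Hx Hv. specialize (Hw x Hx). apply in_strip in Hv.
  destruct Hv as (j & J1 & J2 & ->). left. eexists. split; [|split; [|reflexivity]]; nia.
- intros x y v Hx Hy Hne Hv Hv'. apply in_strip in Hv, Hv'.
  destruct Hv as (j & J1 & J2 & ->), Hv' as (j' & J3 & J4 & E).
  assert (Hwx := Hw x Hx). assert (Hwy := Hw y Hy).
  apply lane_inj in E; [|lia|lia]. apply Hne, (placed_inj c L pos); auto. lia.
Qed.

Lemma chain_arm a k : chain adj (map g (seq a k)).
Proof.
revert a. induction k as [|k IH]; intros a; cbn; [auto|]. split; [|apply IH].
destruct k; cbn; [auto|]. apply (spiral_arm _ _ _ _ _ Hg).
Qed.

Lemma leads_up a d : leads (g a) (map g (seq a (S d))) (g (a + d + n)).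
Proof.
split; [|reflexivity].
rewrite seq_S, map_app. cbn [map]. rewrite <- app_assoc. cbn [app].
apply chain_app. split.
- change [g (a + d)] with (map g [a + d]). rewrite <- map_app, <- seq_S. apply chain_arm.
- cbn. split; auto. apply (spiral_radial _ _ _ _ _ Hg).
Qed.

Lemma leads_down b d : leads (g (b + d)) (rev (map g (seq b (S d)))) (g (b + n)).
Proof.
split.
- apply (chain_rev adj adj_sym (g (b + n) :: map g (seq b (S d)))).
  cbn [chain]. split; [|apply chain_arm]. apply adj_sym, (spiral_radial _ _ _ _ _ Hg).
- rewrite seq_S, map_app, rev_app_distr. reflexivity.
Qed.

(** Within one turn [x0] runs along the arm over unoccupied positions and then goes out radially,
    while every other token makes a single radial step. *)
Lemma linkable_move c Z L pos pos' x0 : paired L -> placed c L pos -> placed c L pos' ->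
  (forall x, In x L -> x <> x0 -> pos' x = pos x /\
     ~ (pos x0 <= pos x <= pos' x0) /\ ~ (pos' x0 <= pos x <= pos x0)) ->
  linkable (c + n) Z L (fun x => pos' x + n) -> linkable c Z L pos.
Proof.
intros HL Hp Hp' Hmv.
set (sweep := if le_dec (pos x0) (pos' x0)
  then map g (seq (pos x0) (S (pos' x0 - pos x0)))
  else rev (map g (seq (pos' x0) (S (pos x0 - pos' x0))))).
assert (Hsw : forall v, In v sweep -> exists k, v = g k /\
   ((pos x0 <= k <= pos' x0) \/ (pos' x0 <= k <= pos x0))).
{ intros v Hv. unfold sweep in Hv. destruct (le_dec (pos x0) (pos' x0)).
  - apply in_map_iff in Hv. destruct Hv as (k & <- & Hk). apply in_seq in Hk.
    exists k. split; [reflexivity|lia].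
  - apply in_rev, in_map_iff in Hv. destruct Hv as (k & <- & Hk). apply in_seq in Hk.
    exists k. split; [reflexivity|lia]. }
assert (Hinj := spiral_injective _ _ _ _ _ Hg).
destruct (Hp) as [Hw _]. destruct (Hp') as [Hw' _].
apply (linkable_prepend _ _ _ _ _ _ _ (fun x => if Nat.eq_dec x x0 then sweep else [g (pos x)]));
  auto; [lia| | | |].
- intros x Hx. destruct (Nat.eq_dec x x0) as [->|Hne].
  + unfold sweep. destruct (le_dec (pos x0) (pos' x0)).
    * replace (pos' x0 + n) with (pos x0 + (pos' x0 - pos x0) + n) by lia. apply leads_up.
    * replace (pos x0) with (pos' x0 + (pos x0 - pos' x0)) at 1 by lia. apply leads_down.
  + destruct (Hmv x Hx Hne) as [-> _]. apply leads_one, (spiral_radial _ _ _ _ _ Hg).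
- intros x Hx. destruct (Nat.eq_dec x x0) as [->|Hne]; [|repeat constructor; tauto].
  unfold sweep. destruct (le_dec (pos x0) (pos' x0)).
  + apply Injective_map_NoDup; [exact Hinj|apply seq_NoDup].
  + apply NoDup_rev, Injective_map_NoDup; [exact Hinj|apply seq_NoDup].
- intros x v Hx Hv. left. destruct (Nat.eq_dec x x0) as [->|Hne].
  + destruct (Hsw v Hv) as (k & -> & Hk). exists k.
    specialize (Hw x0 Hx). specialize (Hw' x0 Hx). split; [lia|]. split; [lia|reflexivity].
  + destruct Hv as [<-|[]]. exists (pos x). specialize (Hw x Hx).
    split; [lia|]. split; [lia|reflexivity].
- intros x y v Hx Hy Hne Hv Hv'.
  destruct (Nat.eq_dec x x0) as [->|Hx0], (Nat.eq_dec y x0) as [->|Hy0]; [congruence| | |].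
  + destruct (Hsw v Hv) as (k & -> & Hk). destruct Hv' as [E|[]]. apply Hinj in E.
    destruct (Hmv y Hy Hy0). lia.
  + destruct (Hsw v Hv') as (k & -> & Hk). destruct Hv as [E|[]]. apply Hinj in E.
    destruct (Hmv x Hx Hx0). lia.
  + destruct Hv as [<-|[]], Hv' as [E|[]]. apply Hinj in E.
    apply Hne, (placed_inj c L pos); auto.
Qed.

Lemma placed_shift c L pos k : placed c L pos -> placed (c + k) L (fun x => pos x + k).
Proof.
intros [H1 H2]. split.
- intros x Hx. specialize (H1 x Hx). lia.
- intros x y Hx Hy H. specialize (H2 x y Hx Hy H). lia.
Qed.

(** The tokens after [x] need distinct positions before the end of the window. Hence packing all
    tokens at that end is the largest placement, pointwise. *)
Lemma placed_upper c L pos x : paired L -> placed c L pos -> In x L ->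
  pos x + length L <= c + n + index L x.
Proof.
intros [ND _] [H1 H2] Hx.
assert (H : forall k y, In y L -> index L y + S k = length L ->
                        pos y + length L <= c + n + index L y).
{ induction k as [|k IH]; intros y Hy E.
  - specialize (H1 y Hy). lia.
  - assert (Hlt : S (index L y) < length L) by lia.
    assert (Hz := nth_In L 0 Hlt). assert (Iz := index_nth L _ 0 ND Hlt).
    assert (Hyz := H2 y _ Hy Hz ltac:(lia)). specialize (IH _ Hz ltac:(lia)). lia. }
assert (Hi := index_lt L x Hx). apply (H (length L - S (index L x))); [exact Hx|lia].
Qed.

Definition packed (c : nat) (L : list nat) (x : nat) : nat := c + index L x.

Lemma placed_packed b c L : c <= b -> b + length L <= c + n -> placed c L (packed b L).
Proof.
intros H1 H2. unfold packed. split.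
- intros x Hx. assert (H := index_lt L x Hx). lia.
- intros x y _ _ H. lia.
Qed.

Definition update (f : nat -> nat) (a b x : nat) : nat := if Nat.eq_dec x a then b else f x.

(** One token moves per turn, highest rank first: those of rank at least [k] have arrived, so the
    token of rank [k - 1] has a free stretch up to its target. *)
Lemma linkable_raise c Z L pos w k : paired L -> placed c L pos -> placed c L w ->
  k <= length L ->
  (forall x, In x L -> pos x <= w x) ->
  (forall x, In x L -> k <= index L x -> pos x = w x) ->
  linkable (c + k * n) Z L (fun x => w x + k * n) -> linkable c Z L pos.
Proof.
intros HL. assert (ND := proj1 HL).
revert c pos w. induction k as [|k IH]; intros c pos w Hp Hw Hk Hle Heq H.
{ rewrite Nat.add_0_r in H. apply (linkable_same _ _ _ L _ w); auto; [tauto| |].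
  - intros x Hx. apply Heq; [exact Hx|lia].
  - revert H. apply linkable_same; [tauto|exact HL|]. intros; lia. }
set (x0 := nth k L 0). assert (Hx0 : In x0 L) by (apply nth_In; lia).
assert (Ix0 : index L x0 = k) by (apply index_nth; auto).
clearbody x0.
assert (Hoth : forall x, In x L -> x <> x0 -> index L x <> k).
{ intros x Hx Hne E. apply Hne, (index_inj L); auto. congruence. }
assert (Hp1 : placed c L (update pos x0 (w x0))).
{ destruct Hp as [P1 P2], Hw as [W1 W2]. unfold update. split.
  - intros x Hx. destruct (Nat.eq_dec x x0) as [->|]; auto.
  - intros x y Hx Hy Hi. specialize (P2 x y Hx Hy Hi). specialize (W2 x y Hx Hy Hi).
    destruct (Nat.eq_dec x x0) as [->|N1], (Nat.eq_dec y x0) as [->|N2]; try lia.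
    + rewrite (Heq y); auto; lia.
    + specialize (Hle x0 Hx0). lia. }
apply (linkable_move c Z L pos (update pos x0 (w x0)) x0); auto.
- intros x Hx Hne. unfold update. destruct (Nat.eq_dec x x0) as [|_]; [congruence|].
  destruct (Nat.eq_dec x0 x0) as [_|]; [|congruence]. split; [reflexivity|].
  specialize (Hoth x Hx Hne). destruct Hp as [P1 P2], Hw as [W1 W2].
  specialize (Hle x0 Hx0).
  destruct (Nat.lt_total (index L x) k) as [Hi|[Hi|Hi]]; [|lia|].
  + specialize (P2 x x0 Hx Hx0 ltac:(lia)). lia.
  + specialize (W2 x0 x Hx0 Hx ltac:(lia)). rewrite (Heq x Hx ltac:(lia)). lia.
- apply (IH (c + n) _ (fun x => w x + n)).
  + now apply placed_shift.
  + now apply placed_shift.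
  + lia.
  + intros x Hx. unfold update. specialize (Hle x Hx). destruct (Nat.eq_dec x x0); subst; lia.
  + intros x Hx Hi. unfold update. destruct (Nat.eq_dec x x0) as [->|Hne]; [reflexivity|].
    rewrite Heq; auto. specialize (Hoth x Hx Hne). lia.
  + replace (c + n + k * n) with (c + S k * n) by lia.
    revert H. apply linkable_same; [tauto|exact HL|]. intros; lia.
Qed.

(** The mirror image of raising: lowest rank first, with the last [k] tokens still to move. *)
Lemma linkable_lower c Z L pos w k : paired L -> placed c L pos -> placed c L w ->
  k <= length L ->
  (forall x, In x L -> w x <= pos x) ->
  (forall x, In x L -> index L x + k < length L -> pos x = w x) ->
  linkable (c + k * n) Z L (fun x => w x + k * n) -> linkable c Z L pos.
Proof.
intros HL. assert (ND := proj1 HL).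
revert c pos w. induction k as [|k IH]; intros c pos w Hp Hw Hk Hle Heq H.
{ rewrite Nat.add_0_r in H. apply (linkable_same _ _ _ L _ w); auto; [tauto| |].
  - intros x Hx. apply Heq; [exact Hx|]. assert (Hi := index_lt L x Hx). lia.
  - revert H. apply linkable_same; [tauto|exact HL|]. intros; lia. }
set (i := length L - S k).
set (x0 := nth i L 0). assert (Hx0 : In x0 L) by (apply nth_In; lia).
assert (Ix0 : index L x0 = i) by (apply index_nth; auto; lia).
clearbody x0.
assert (Hoth : forall x, In x L -> x <> x0 -> index L x <> i).
{ intros x Hx Hne E. apply Hne, (index_inj L); auto. congruence. }
assert (Hp1 : placed c L (update pos x0 (w x0))).
{ destruct Hp as [P1 P2], Hw as [W1 W2]. unfold update. split.
  - intros x Hx. destruct (Nat.eq_dec x x0) as [->|]; auto.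
  - intros x y Hx Hy Hi. specialize (P2 x y Hx Hy Hi). specialize (W2 x y Hx Hy Hi).
    destruct (Nat.eq_dec x x0) as [->|N1], (Nat.eq_dec y x0) as [->|N2]; try lia.
    + specialize (Hle x0 Hx0). lia.
    + rewrite (Heq x); auto; lia. }
apply (linkable_move c Z L pos (update pos x0 (w x0)) x0); auto.
- intros x Hx Hne. unfold update. destruct (Nat.eq_dec x x0) as [|_]; [congruence|].
  destruct (Nat.eq_dec x0 x0) as [_|]; [|congruence]. split; [reflexivity|].
  specialize (Hoth x Hx Hne). destruct Hp as [P1 P2], Hw as [W1 W2].
  specialize (Hle x0 Hx0).
  destruct (Nat.lt_total (index L x) i) as [Hi|[Hi|Hi]]; [|lia|].
  + specialize (W2 x x0 Hx Hx0 ltac:(lia)). rewrite (Heq x Hx ltac:(lia)). lia.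
  + specialize (P2 x0 x Hx0 Hx ltac:(lia)). lia.
- apply (IH (c + n) _ (fun x => w x + n)).
  + now apply placed_shift.
  + now apply placed_shift.
  + lia.
  + intros x Hx. unfold update. specialize (Hle x Hx). destruct (Nat.eq_dec x x0); subst; lia.
  + intros x Hx Hi. unfold update. destruct (Nat.eq_dec x x0) as [->|Hne]; [reflexivity|].
    rewrite Heq; auto. specialize (Hoth x Hx Hne). lia.
  + replace (c + n + k * n) with (c + S k * n) by lia.
    revert H. apply linkable_same; [tauto|exact HL|]. intros; lia.
Qed.

(* All tokens are first pushed to the end of the window and then lowered to their targets. *)
Lemma linkable_rearrange c Z L pos w q : paired L -> length L <= n ->
  placed c L pos -> placed (c + q * n) L w -> 2 * length L <= q ->
  linkable (c + q * n) Z L w -> linkable c Z L pos.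
Proof.
intros HL Hlen Hp Hw Hq H.
set (m := length L). set (top := packed (c + n - m) L).
assert (Htop : placed c L top) by (apply placed_packed; lia).
set (w0 := fun x => w x - q * n).
assert (Hw0 : placed c L w0).
{ destruct Hw as [W1 W2]. unfold w0. split.
  - intros x Hx. specialize (W1 x Hx). lia.
  - intros x y Hx Hy Hi. specialize (W2 x y Hx Hy Hi). specialize (W1 x Hx). lia. }
apply (linkable_raise c Z L pos top m); auto.
{ intros x Hx. assert (Hu := placed_upper c L pos x HL Hp Hx).
  unfold top, packed. lia. }
{ intros x Hx Hi. assert (Hlt := index_lt L x Hx). lia. }
apply (linkable_lower _ Z L _ (fun x => w0 x + m * n) m); auto.
{ now apply placed_shift. }
{ now apply placed_shift. }
{ intros x Hx. assert (Hu := placed_upper c L w0 x HL Hw0 Hx).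
  unfold top, packed. lia. }
{ intros x Hx Hi. lia. }
apply (linkable_straight _ Z L _ (q - 2 * m)); [exact HL| |].
{ now apply placed_shift, placed_shift. }
replace (c + m * n + m * n + (q - 2 * m) * n) with (c + q * n).
- revert H. apply linkable_same; [tauto|exact HL|]. intros x Hx.
  destruct Hw as [W1 _]. specialize (W1 x Hx). unfold w0.
  rewrite Nat.mul_sub_distr_r. assert (2 * m * n <= q * n) by (apply Nat.mul_le_mono_r; lia). lia.
- rewrite Nat.mul_sub_distr_r. assert (2 * m * n <= q * n) by (apply Nat.mul_le_mono_r; lia). lia.
Qed.

(* A window that starts in the middle of another one: the tokens are gathered on one side of the new start,
   and if they lie before it, each of them makes one turn. *)
Lemma linkable_rebase c Z L pos c' w : paired L -> 2 * length L <= n ->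
  placed c L pos -> c + (4 * length L) * n <= c' -> placed c' L w ->
  linkable c' Z L w -> linkable c Z L pos.
Proof.
intros HL Hlen Hp Hc Hw H.
set (m := length L) in *.
assert (Hmod := Nat.div_mod_eq (c' - c) n).
assert (Hlt : (c' - c) mod n < n) by (apply Nat.mod_upper_bound; lia).
set (d := (c' - c) mod n) in *. set (q := (c' - c) / n) in *.
assert (Hc' : c' = c + d + q * n) by lia. clearbody d q. clear Hmod.
assert (Hq : 4 * m <= q) by nia.
(* Gathering takes [2 * m] turns in the old window and spreading takes [2 * m] in the new one,
   whence the factor 4. *)
set (c1 := c + 2 * m * n).
assert (Ec' : c' = c1 + d + (q - 2 * m) * n).
{ unfold c1. rewrite Nat.mul_sub_distr_r.
  assert (2 * m * n <= q * n) by (apply Nat.mul_le_mono_r; lia). lia. }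
assert (Hfin : forall u, placed (c1 + d) L u -> linkable (c1 + d) Z L u).
{ intros u Hu. apply (linkable_rearrange _ Z L u w (q - 2 * m)); auto; fold m; try lia.
  - now rewrite <- Ec'.
  - now rewrite <- Ec'. }
destruct (le_lt_dec (d + m) n) as [Hd|Hd].
- apply (linkable_rearrange c Z L pos (packed (c1 + d) L) (2 * m)); auto; fold m; try lia.
  { apply placed_packed; fold m; lia. }
  apply (linkable_later _ (c1 + d)); [exact HL|unfold c1; lia|].
  apply Hfin, placed_packed; fold m; lia.
(* Here [d + m > n], so [2 * m <= n] gives [m <= d]: the packed tokens fit before the new start, and
   one radial step carries them past it. *)
- apply (linkable_rearrange c Z L pos (packed c1 L) (2 * m)); auto; fold m; try lia.
  { apply placed_packed; fold m; lia. }
  assert (Hidx : forall x, In x L -> index L x < m) by (intros; now apply index_lt).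
  apply (linkable_prepend _ _ (c1 + d) Z L _ (packed (c1 + n) L) (fun x => [g (packed c1 L x)])); auto.
  + unfold c1. lia.
  + intros x Hx. replace (packed (c1 + n) L x) with (packed c1 L x + n) by (unfold packed; lia).
    apply leads_one, (spiral_radial _ _ _ _ _ Hg).
  + intros x Hx. repeat constructor; tauto.
  + intros x v Hx [<-|[]]. left. exists (packed c1 L x). specialize (Hidx x Hx).
    unfold packed, c1. split; [lia|]. split; [lia|reflexivity].
  + intros x y v Hx Hy Hne [<-|[]] [E|[]]. apply (spiral_injective _ _ _ _ _ Hg) in E.
    apply Hne, (index_inj L); auto. unfold packed in E. lia.
  + apply Hfin, placed_packed; fold m; lia.
Qed.

(** * Overtaking by means of one event *)

Lemma chord_short c Z : chord adj n t g hub c Z ->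
  exists a b P e q1 q2, c <= a /\ c <= b /\ ear adj t g hub Z a P b /\
    2 <= e /\ 2 * e <= n /\ b + q1 * n = a + e + q2 * n.
Proof.
intros (a & b & P & e & q1 & q2 & Ha & Hb & HP & He1 & He2 & E).
destruct (le_lt_dec (2 * e) n) as [He|He].
- exists a, b, P, e, q1, q2. auto 10.
(* A chord that spans more than half of the rays is read backwards and then spans [n - e]. *)
- exists b, a, (rev P), (n - e), (S q2), q1. destruct HP as (W & ND & O).
  split; [exact Hb|]. split; [exact Ha|]. split; [|nia].
  split; [now apply walk_rev|]. split; [now apply NoDup_rev|].
  intros v Hv. apply O. now apply in_rev.
Qed.

Lemma outside_not_lane Z v c x j : outside Z v -> v <> lane c x j.
Proof. intros [H _]. apply H. Qed.

Ltac lane_cases :=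
  repeat match goal with
  | H : In _ (_ ++ _) |- _ => apply in_app_or in H; destruct H as [H|H]
  | H : In _ (_ :: _) |- _ => destruct H as [H|H]
  | H : In _ [] |- _ => destruct H
  | H : In _ (strip _ _ _ _) |- _ =>
      let j := fresh "j" in let J := fresh "J" in
      apply in_strip in H; destruct H as (j & J & ? & H)
  end.

Ltac lane_clash :=
  try match goal with H : lane ?c ?x ?i = ?v, H' : ?v = lane ?c ?y ?j |- _ =>
    rewrite H' in H end;
  try match goal with H : ?v = lane ?c ?x ?i, H' : ?v = lane ?c ?y ?j |- _ =>
    rewrite H' in H end;
  try match goal with H : lane ?c ?x ?i = ?v, H' : lane ?c ?y ?j = ?v |- _ =>
    rewrite <- H' in H end;
  match goal with
  | H : lane _ _ _ = lane _ _ _ |- _ => apply lane_inj in H; lia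
  | H : outside _ ?v, H' : ?v = lane _ _ _ |- _ => exact (outside_not_lane _ _ _ _ _ H H')
  | H : outside _ ?v, H' : lane _ _ _ = ?v |- _ =>
      symmetry in H'; exact (outside_not_lane _ _ _ _ _ H H')
  end.

(** Both kinds of event get one form: ray 0 is led to ray [e], past ray 1, which is led to itself.
    On the spiral only rays 0, 1 and [e] are used, so tokens beyond ray [e] can go straight out. *)
Lemma event_overtaking C Z : event (C + 2 * n) Z ->
  exists c e q sA sB, C <= c /\ c < C + n /\ 1 <= q /\ 2 <= e /\ 2 * e <= n /\
    leads (lane c 0 0) sA (lane c e q) /\ leads (lane c 1 0) sB (lane c 1 q) /\
    NoDup (sA ++ sB) /\
    (forall v, In v (sA ++ sB) -> outside Z v \/
       exists x j, (x = 0 \/ x = 1 \/ x = e) /\ j < q /\ v = lane c x j).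
Proof.
assert (Hbase : forall a, C + 2 * n <= a -> exists c i, C <= c /\ c < C + n /\ 1 <= i /\ a = c + i * n).
{ intros a Ha. assert (Hmod := Nat.div_mod_eq (a - C) n).
  assert (Hlt : (a - C) mod n < n) by (apply Nat.mod_upper_bound; lia).
  exists (C + (a - C) mod n), ((a - C) / n). repeat split; nia. }
intros [Hch|Hby].
- destruct (chord_short _ _ Hch) as (a & b & P & e & q1 & q2 & Ha & Hb & (W & ND & O) & He1 & He2 & E).
  destruct (Hbase a Ha) as (c & i & Hc1 & Hc2 & Hi & ->).
  (* The margin of two turns puts [b] beyond [c + e], so its row [i'] is a natural number. *)
  assert (Hi' : exists i', b = c + (e + i' * n)).
  { exists (i + q2 - q1). assert (q1 <= i + q2) by nia. rewrite Nat.mul_sub_distr_r. nia. }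
  destruct Hi' as [i' ->].
  (* The row [i + i' + 1] is beyond both ends of the chord, so both tokens can stop in it. *)
  exists c, e, (i + i' + 1), (strip c 0 0 i ++ (lane c 0 i :: P) ++ strip c e i' (i + 1)),
    (strip c 1 0 (i + i' + 1)).
  split; [exact Hc1|]. split; [exact Hc2|]. split; [lia|]. split; [exact He1|].
  split; [exact He2|]. split; [|split; [|split]].
  + apply (leads_app adj _ _ (lane c 0 i)); [apply (strip_leads c 0 0)|].
    apply (leads_app adj _ _ (lane c e i')).
    * apply leads_walk. replace (lane c 0 i) with (g (c + i * n)) by (unfold lane; f_equal; lia).
      exact W.
    * replace (i + i' + 1) with (i' + (i + 1)) by lia. apply strip_leads.
  + apply (strip_leads c 1 0).
  + rewrite <- !app_assoc.
    apply NoDup_app; [apply strip_nodup; lia| |intros v Hv Hv'; lane_cases; try lane_clash].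
    * cbn. constructor; [intros Hv; lane_cases; try lane_clash|].
      { apply O in Hv. now apply (outside_not_lane _ _ c 0 i Hv). }
      apply NoDup_app; [exact ND| |intros v Hv Hv'; apply O in Hv; lane_cases; try lane_clash].
      apply NoDup_app; [apply strip_nodup; lia|apply strip_nodup; lia|].
      intros v Hv Hv'. lane_cases; try lane_clash.
    * apply O in Hv'. lane_clash.
  + intros v Hv. lane_cases; try (left; now apply O);
      right; [exists 0, j|exists 0, i|exists e, j|exists 1, j]; repeat split; auto; lia.
- destruct Hby as (y0 & q & A & B & Hy0 & Hq & WA & WB & ND & O).
  destruct (Hbase y0 Hy0) as (c & i & Hc1 & Hc2 & Hi & ->).
  assert (O' : forall v, In v (A ++ B) -> outside Z v \/ exists j, i < j /\ j <= i + 1 + q /\ v = lane c 0 j).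
  { intros v Hv. destruct (O v Hv) as [H|(j & Hj & ->)]; [auto|right].
    exists (i + 1 + j). split; [lia|]. split; [lia|]. unfold lane. f_equal. lia. }
  clear O. apply NoDup_app_remove_l in ND as NDB. apply NoDup_app_remove_r in ND as NDA.
  (* [A] ends on ray 1 in row [i + 1] and steps on to ray 2; [B] rejoins ray 1 only in row
     [i + 1 + q], which is later because [q] is positive. *)
  exists c, 2, (i + q + 2),
    (strip c 0 0 i ++ (lane c 0 i :: A) ++ [lane c 1 (i + 1)] ++ strip c 2 (i + 1) (q + 1)),
    (strip c 1 0 i ++ (lane c 1 i :: B) ++ strip c 1 (i + 1 + q) 1).
  split; [exact Hc1|]. split; [exact Hc2|]. split; [lia|]. split; [lia|].
  split; [lia|]. split; [|split; [|split]].
  + apply (leads_app adj _ _ (lane c 0 i)); [apply (strip_leads c 0 0)|].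
    apply (leads_app adj _ _ (lane c 1 (i + 1))).
    { apply leads_walk. replace (lane c 0 i) with (g (c + i * n)) by (unfold lane; f_equal; lia).
      replace (lane c 1 (i + 1)) with (g (c + i * n + n + 1)) by (unfold lane; f_equal; lia).
      exact WA. }
    apply (leads_app adj _ _ (lane c 2 (i + 1))).
    { apply leads_one. unfold lane.
      replace (c + (2 + (i + 1) * n)) with (S (c + (1 + (i + 1) * n))) by lia.
      apply (spiral_arm _ _ _ _ _ Hg). }
    replace (i + q + 2) with (i + 1 + (q + 1)) by lia. apply strip_leads.
  + apply (leads_app adj _ _ (lane c 1 i)); [apply (strip_leads c 1 0)|].
    apply (leads_app adj _ _ (lane c 1 (i + 1 + q))).
    { apply leads_walk. replace (lane c 1 i) with (g (c + i * n + 1)) by (unfold lane; f_equal; lia).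
      replace (lane c 1 (i + 1 + q)) with (g (c + i * n + n + 1 + q * n)) by (unfold lane; f_equal; lia).
      exact WB. }
    replace (i + q + 2) with (i + 1 + q + 1) by lia. apply strip_leads.
  + assert (OA : forall v, In v A -> outside Z v \/ exists j, i < j /\ j <= i + 1 + q /\ v = lane c 0 j).
    { intros v Hv. apply O', in_or_app. auto. }
    assert (OB : forall v, In v B -> outside Z v \/ exists j, i < j /\ j <= i + 1 + q /\ v = lane c 0 j).
    { intros v Hv. apply O', in_or_app. auto. }
    assert (HAB : forall v, In v A -> ~ In v B).
    { clear - ND. intros v HA HB. induction A as [|a A IH]; [destruct HA|].
      inversion_clear ND as [|? ? H1 H2]. destruct HA as [->|HA].
      - apply H1, in_or_app. auto.
      - auto. }
    assert (Hcl : forall v, In v A \/ In v B -> forall x j, x < n -> v = lane c x j -> x = 0 /\ i < j).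
    { intros v Hv x j Hx ->.
      assert (Hv' : outside Z (lane c x j) \/ exists j', i < j' /\ j' <= i + 1 + q /\ lane c x j = lane c 0 j').
      { destruct Hv; auto. }
      destruct Hv' as [Hv'|(j' & J1 & J2 & E)]; [exfalso; now apply (outside_not_lane _ _ c x j Hv')|].
      apply lane_inj in E; lia. }
    assert (Hclash : forall v x j, In v A \/ In v B -> x < n -> v = lane c x j \/ lane c x j = v ->
              x <> 0 \/ j <= i -> False).
    { intros v x j Hv Hx E Hne. destruct (Hcl v Hv x j Hx); [destruct E; auto|lia]. }
    rewrite <- !app_assoc.
    apply NoDup_app; [apply strip_nodup; lia| |].
    * cbn. constructor.
      { intros Hv. lane_cases; try lane_clash; eapply (Hclash _ 0 i); eauto; lia. }
      apply NoDup_app; [exact NDA| |].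
      { constructor.
        { intros Hv. lane_cases; try lane_clash; eapply (Hclash _ 1 (i + 1)); eauto; lia. }
        apply NoDup_app; [apply strip_nodup; lia| |].
        { apply NoDup_app; [apply strip_nodup; lia| |].
          { cbn. constructor.
            { intros Hv. apply in_app_or in Hv. destruct Hv as [Hv|[Hv|[]]].
              - eapply (Hclash _ 1 i); eauto; lia.
              - apply lane_inj in Hv; lia. }
            apply NoDup_app; [exact NDB|repeat constructor; tauto|].
            intros v Hv [Hv'|[]]. eapply (Hclash _ 1 (i + 1 + q)); eauto; lia. }
          { intros v Hv Hv'. lane_cases; try lane_clash; eapply (Hclash _ 1 j); eauto; lia. } }
        { intros v Hv Hv'. lane_cases; try lane_clash; eapply (Hclash _ 2 j); eauto; lia. } }
      { intros v Hv Hv'. cbn in Hv'. destruct Hv' as [Hv'|Hv'].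
        - eapply (Hclash _ 1 (i + 1)); eauto; lia.
        - lane_cases; try (now apply (HAB v)).
          + eapply (Hclash _ 2 j); eauto; lia.
          + eapply (Hclash _ 1 j); eauto; lia.
          + eapply (Hclash _ 1 i); eauto; lia.
          + eapply (Hclash _ 1 (i + 1 + q)); eauto; lia. }
    * intros v Hv Hv'. lane_cases; try lane_clash; eapply (Hclash _ 0 j); eauto; lia.
  + assert (HQ : forall v, outside Z v \/ (exists j, i < j /\ j <= i + 1 + q /\ v = lane c 0 j) ->
       outside Z v \/ exists x j, (x = 0 \/ x = 1 \/ x = 2) /\ j < i + q + 2 /\ v = lane c x j).
    { intros v [H|(j & J1 & J2 & ->)]; [auto|right]. exists 0, j. repeat split; auto; lia. }
    intros v Hv. lane_cases; try (apply HQ, O', in_or_app; now auto);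
      right; [exists 0, j|exists 0, i|exists 1, (i + 1)|exists 2, j|exists 1, j|exists 1, i|exists 1, j];
      repeat split; auto; lia.
Qed.

(** * Bringing partners together in the cyclic order *)

Definition routable (L : list nat) : Prop :=
  forall c Z pos, placed c L pos -> linkable c Z L pos.

Context (Hev : forall c Z, event c Z).

(** After the event [y], on ray 1, is first in the window and [x], on ray [e], is second. With the
    next window starting at [c2 + 2], one radial step makes [y] the last token. *)
Lemma routable_overtake x y L : paired (x :: y :: L) -> 2 * length (x :: y :: L) <= n ->
  routable (x :: L ++ [y]) -> routable (x :: y :: L).
Proof.
intros HT Hlen HR c Z pos Hp.
set (T := x :: y :: L) in *. set (m := length T) in *.
assert (Hm : m = S (S (length L))) by reflexivity.
(* The [4 * m] turns are the room [linkable_rebase] takes to set [x] and [y] on rays 0 and 1 and the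
   others beyond ray [e]. *)
destruct (event_overtaking (c + 4 * m * n) Z (Hev _ _))
  as (c1 & e & q & sA & sB & C1 & C2 & Hq & He1 & He2 & LA & LB & ND & O).
assert (NDT := proj1 HT). unfold T in NDT.
inversion_clear NDT as [|? ? Nx NDT']. inversion_clear NDT' as [|? ? Ny NDL].
assert (Nxy : x <> y) by (intros ->; apply Nx; cbn; auto).
assert (NxL : ~ In x L) by (intros Hx; apply Nx; cbn; auto). clear Nx.
assert (HinT : forall z, In z T -> z = x \/ z = y \/ (z <> x /\ z <> y /\ In z L)).
{ intros z [->|[->|Hz]]; auto. right. right. split; [|split]; congruence. }
assert (IL : forall z, In z L -> index L z < length L) by (intros; now apply index_lt).
pose (by_token := fun (A : Type) (a b : A) (h : nat -> A) z =>
   if Nat.eq_dec z x then a else if Nat.eq_dec z y then b else h z).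
assert (Bx : forall A a b h, by_token A a b h x = a).
{ intros. unfold by_token. destruct (Nat.eq_dec x x); congruence. }
assert (By : forall A a b h, by_token A a b h y = b).
{ intros. unfold by_token. destruct (Nat.eq_dec y x); [congruence|].
  destruct (Nat.eq_dec y y); congruence. }
assert (Bz : forall A a b h z, z <> x -> z <> y -> by_token A a b h z = h z).
{ intros. unfold by_token. destruct (Nat.eq_dec z x); [congruence|].
  destruct (Nat.eq_dec z y); congruence. }
clearbody by_token.
assert (Ix : index T x = 0) by (cbn; destruct (Nat.eq_dec x x); congruence).
assert (Iy : index T y = 1).
{ cbn. destruct (Nat.eq_dec x y); [congruence|]. destruct (Nat.eq_dec y y); congruence. }
assert (Iz : forall z, z <> x -> z <> y -> index T z = S (S (index L z))).
{ intros z H1 H2. cbn. destruct (Nat.eq_dec x z); [congruence|].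
  destruct (Nat.eq_dec y z); congruence. }
(* From [2 * e <= n] and [2 * m <= n] these rays all have numbers below [n]. *)
set (row z := e + 1 + index L z).
set (w := by_token nat c1 (c1 + 1) (fun z => c1 + row z)).
assert (Hw : placed c1 T w).
{ split.
  - intros z Hz. unfold w, row. destruct (HinT z Hz) as [->|[->|(H1 & H2 & H3)]].
    + rewrite Bx. lia.
    + rewrite By. lia.
    + rewrite Bz by auto. specialize (IL z H3). lia.
  - intros z z' Hz Hz'. unfold w, row.
    destruct (HinT z Hz) as [->|[->|(H1 & H2 & H3)]], (HinT z' Hz') as [->|[->|(H1' & H2' & H3')]];
    rewrite ?Bx, ?By, ?Bz, ?Ix, ?Iy, ?Iz by auto; lia. }
apply (linkable_rebase c Z T pos c1 w); auto.
set (c2 := c1 + q * n).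
set (w1 := by_token nat (c2 + e) (c2 + 1) (fun z => c2 + row z)).
set (s1 := by_token (list U) sA sB (fun z => strip c1 (row z) 0 q)).
assert (Hrow : forall z, In z L -> row z < n) by (intros z Hz; specialize (IL z Hz); unfold row; lia).
assert (Ox : forall v, In v sA -> In v (sA ++ sB)) by (intros; apply in_or_app; auto).
assert (Oy : forall v, In v sB -> In v (sA ++ sB)) by (intros; apply in_or_app; auto).
assert (Onot : forall v z, In z L -> In v (sA ++ sB) -> ~ In v (strip c1 (row z) 0 q)).
{ intros v z Hz Hv Hv'. apply in_strip in Hv'. destruct Hv' as (j & J1 & J2 & ->).
  destruct (O _ Hv) as [H|(r & j' & Hr & J3 & E)].
  - now apply (outside_not_lane _ _ c1 (row z) j H).
  - apply lane_inj in E; [unfold row in E; lia|now apply Hrow|lia]. }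
apply (linkable_prepend c1 Z c2 (Z ++ sA ++ sB) T w w1 s1); auto.
{ unfold c2. lia. }
{ intros v Hv. apply in_or_app. auto. }
{ intros z Hz. unfold w, w1, s1. destruct (HinT z Hz) as [->|[->|(H1 & H2 & H3)]].
  - rewrite !Bx. replace (g c1) with (lane c1 0 0) by (unfold lane; f_equal; lia).
    replace (g (c2 + e)) with (lane c1 e q) by (unfold lane, c2; f_equal; lia). exact LA.
  - rewrite !By. replace (g (c1 + 1)) with (lane c1 1 0) by (unfold lane; f_equal; lia).
    replace (g (c2 + 1)) with (lane c1 1 q) by (unfold lane, c2; f_equal; lia). exact LB.
  - rewrite !Bz by auto.
    replace (g (c1 + row z)) with (lane c1 (row z) 0) by (unfold lane; f_equal; lia).
    replace (g (c2 + row z)) with (lane c1 (row z) (0 + q)) by (unfold lane, c2; f_equal; lia).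
    apply strip_leads. }
{ intros z Hz. unfold s1. destruct (HinT z Hz) as [->|[->|(H1 & H2 & H3)]].
  - rewrite Bx. now apply NoDup_app_remove_r in ND.
  - rewrite By. now apply NoDup_app_remove_l in ND.
  - rewrite Bz by auto. now apply strip_nodup, Hrow. }
{ assert (HO : forall v, In v (sA ++ sB) ->
     (exists k, c1 <= k /\ k < c2 /\ v = g k) \/ (outside Z v /\ In v (Z ++ sA ++ sB))).
  { intros v Hv. destruct (O v Hv) as [H|(r & j & Hr & J & ->)].
    - right. split; [exact H|]. apply in_or_app. auto.
    - left. eexists. split; [|split; [|reflexivity]]; unfold c2; nia. }
  intros z v Hz. unfold s1. destruct (HinT z Hz) as [->|[->|(H1 & H2 & H3)]].
  - rewrite Bx. auto.
  - rewrite By. auto.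
  - rewrite Bz by auto. intros Hv. apply in_strip in Hv. destruct Hv as (j & J1 & J2 & ->).
    left. specialize (Hrow z H3). eexists. split; [|split; [|reflexivity]]; unfold c2; nia. }
{ assert (HAB : forall v, In v sA -> ~ In v sB).
  { clear - ND. intros v HA HB. induction sA as [|a A IH]; [destruct HA|].
    inversion_clear ND as [|? ? H1 H2]. destruct HA as [->|HA].
    - apply H1, in_or_app. auto.
    - auto. }
  intros z z' v Hz Hz' Hne. unfold s1.
  destruct (HinT z Hz) as [->|[->|(H1 & H2 & H3)]], (HinT z' Hz') as [->|[->|(H1' & H2' & H3')]];
    rewrite ?Bx, ?By, ?Bz by auto; try congruence; try (intros Hv Hv'; now apply (HAB v)).
  - intros Hv Hv'. now apply (Onot v z' H3' (Ox v Hv)).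
  - intros Hv Hv'. now apply (Onot v z' H3' (Oy v Hv)).
  - intros Hv Hv'. now apply (Onot v z H3 (Ox v Hv')).
  - intros Hv Hv'. now apply (Onot v z H3 (Oy v Hv')).
  - intros Hv Hv'. apply in_strip in Hv, Hv'. destruct Hv as (j & _ & _ & ->), Hv' as (j' & _ & _ & E).
    apply lane_inj in E; [|now apply Hrow|now apply Hrow].
    apply Hne, (index_inj L); auto. unfold row in E. lia. }
set (w2 := by_token nat (c2 + e) (c2 + 1 + n) (fun z => c2 + row z)).
apply (linkable_prepend c2 _ (c2 + 2) (Z ++ sA ++ sB) T w1 w2
  (by_token (list U) [] [g (c2 + 1)] (fun _ => []))); auto; try lia.
{ intros z Hz. unfold w1, w2. destruct (HinT z Hz) as [->|[->|(H1 & H2 & H3)]].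
  - rewrite !Bx. apply leads_nil.
  - rewrite !By. apply leads_one, (spiral_radial _ _ _ _ _ Hg).
  - rewrite !Bz by auto. apply leads_nil. }
{ intros z Hz. destruct (HinT z Hz) as [->|[->|(H1 & H2 & H3)]];
  rewrite ?Bx, ?By, ?Bz by auto; repeat constructor; tauto. }
{ intros z v Hz. destruct (HinT z Hz) as [->|[->|(H1 & H2 & H3)]];
  rewrite ?Bx, ?By, ?Bz by auto; intros Hv; try (now destruct Hv).
  destruct Hv as [<-|[]]. left. exists (c2 + 1). split; [lia|]. split; [lia|reflexivity]. }
{ intros z z' v Hz Hz' Hne.
  destruct (HinT z Hz) as [->|[->|(H1 & H2 & H3)]], (HinT z' Hz') as [->|[->|(H1' & H2' & H3')]];
    rewrite ?Bx, ?By, ?Bz by auto; auto; congruence. }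
apply (linkable_same _ _ T (x :: L ++ [y]) _ w2); auto.
{ intros z. unfold T. cbn. rewrite in_app_iff. cbn. tauto. }
apply HR.
assert (HinR : forall z, In z (x :: L ++ [y]) -> In z T).
{ intros z. unfold T. cbn. rewrite in_app_iff. cbn. tauto. }
assert (Rx : index (x :: L ++ [y]) x = 0) by (cbn; destruct (Nat.eq_dec x x); congruence).
assert (Ry : index (x :: L ++ [y]) y = S (length L)).
{ cbn. destruct (Nat.eq_dec x y); [congruence|]. rewrite index_app_r by exact Ny. cbn.
  destruct (Nat.eq_dec y y); [lia|congruence]. }
assert (Rz : forall z, z <> x -> In z L -> index (x :: L ++ [y]) z = S (index L z)).
{ intros z H1 H2. cbn. destruct (Nat.eq_dec x z); [congruence|]. now rewrite index_app_l. }
split.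
- intros z Hz. unfold w2, row. destruct (HinT z (HinR z Hz)) as [->|[->|(H1 & H2 & H3)]].
  + rewrite Bx. lia.
  + rewrite By. lia.
  + rewrite Bz by auto. specialize (IL z H3). lia.
- intros z z' Hz Hz'. unfold w2, row.
  destruct (HinT z (HinR z Hz)) as [->|[->|(H1 & H2 & H3)]],
    (HinT z' (HinR z' Hz')) as [->|[->|(H1' & H2' & H3')]];
  rewrite ?Bx, ?By, ?Bz, ?Rx, ?Ry, ?Rz by auto;
  repeat match goal with H : In _ L |- _ => apply IL in H end; lia.
Qed.

(** Partners packed next to each other are joined by an arm edge; the other tokens are linked from
    [c1 + 2] on, out of reach of that edge. *)
Lemma routable_join x L : paired (x :: pi x :: L) -> 2 * length (x :: pi x :: L) <= n ->
  routable L -> routable (x :: pi x :: L).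
Proof.
intros HT Hlen HR c Z pos Hp.
set (y := pi x) in *. set (T := x :: y :: L) in *. set (m := length T) in *.
assert (Hm : m = S (S (length L))) by reflexivity.
assert (NDT := proj1 HT). unfold T in NDT.
inversion_clear NDT as [|? ? Nx NDT']. inversion_clear NDT' as [|? ? Ny NDL].
assert (Nxy : x <> y) by (intros E; apply Nx; cbn; auto).
assert (NxL : ~ In x L) by (intros Hx; apply Nx; cbn; auto). clear Nx.
assert (HpL : forall z, In z L -> In (pi z) L).
{ intros z Hz. assert (Hpz : In (pi z) T) by (apply HT; cbn; auto).
  destruct Hpz as [E|[E|H]]; [| |exact H]; exfalso.
  - apply Ny. unfold y. rewrite E, pi_invol. exact Hz.
  - apply NxL. rewrite <- (pi_invol x). fold y. rewrite E, pi_invol. exact Hz. }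
set (c1 := c + 4 * m * n).
apply (linkable_rebase c Z T pos c1 (packed c1 T)); auto.
{ apply placed_packed; fold m; lia. }
assert (Ix : packed c1 T x = c1).
{ unfold packed. cbn. destruct (Nat.eq_dec x x); [lia|congruence]. }
assert (Iy : packed c1 T y = c1 + 1).
{ unfold packed. cbn. destruct (Nat.eq_dec x y); [congruence|].
  destruct (Nat.eq_dec y y); [lia|congruence]. }
assert (Iz : forall z, In z L -> packed c1 T z = packed (c1 + 2) L z).
{ intros z Hz. unfold packed. cbn. destruct (Nat.eq_dec x z) as [->|]; [tauto|].
  destruct (Nat.eq_dec y z) as [E|]; [subst z; tauto|]. lia. }
destruct (HR (c1 + 2) Z (packed (c1 + 2) L)) as (P & P1 & P2 & P3 & P4).
{ apply placed_packed; lia. }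
assert (Hpx : pi y = x) by apply pi_invol.
exists (fun z => if Nat.eq_dec z x then [g c1; g (c1 + 1)]
             else if Nat.eq_dec z y then [g (c1 + 1); g c1] else P z).
assert (HinT : forall z, In z T -> z = x \/ z = y \/ (z <> x /\ z <> y /\ In z L)).
{ intros z [->|[->|Hz]]; auto. right. right. split; [|split]; congruence. }
assert (Hadj : adj (g c1) (g (c1 + 1))).
{ rewrite Nat.add_1_r. apply (spiral_arm _ _ _ _ _ Hg). }
assert (Hg1 : g c1 <> g (c1 + 1)).
{ intros E. apply (spiral_injective _ _ _ _ _ Hg) in E. lia. }
assert (Hnew : forall v, v = g c1 \/ v = g (c1 + 1) -> allowed c1 Z v).
{ intros v [->| ->]; left; eexists; (split; [|reflexivity]); lia. }
assert (Hold : forall z v, In z L -> In v (P z) -> v <> g c1 /\ v <> g (c1 + 1)).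
{ intros z v Hz Hv. destruct (P3 z v Hz Hv) as [(k & K & ->)|[O _]]; [|auto].
  split; intros E; apply (spiral_injective _ _ _ _ _ Hg) in E; lia. }
split; [|split; [|split]].
- intros z Hz. destruct (HinT z Hz) as [->|[->|(H1 & H2 & H3)]].
  + destruct (Nat.eq_dec x x); [|congruence]. fold y. rewrite Ix, Iy. split; cbn; auto.
  + destruct (Nat.eq_dec y x); [congruence|]. destruct (Nat.eq_dec y y); [|congruence].
    rewrite Hpx, Ix, Iy. split; cbn; auto.
  + destruct (Nat.eq_dec z x); [congruence|]. destruct (Nat.eq_dec z y); [congruence|].
    rewrite !Iz by auto. auto.
- intros z Hz. destruct (Nat.eq_dec z x); [|destruct (Nat.eq_dec z y)].
  + repeat constructor; cbn; intuition congruence.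
  + repeat constructor; cbn; intuition congruence.
  + apply P2. destruct (HinT z Hz) as [?|[?|?]]; tauto.
- intros z v Hz Hv. destruct (Nat.eq_dec z x); [|destruct (Nat.eq_dec z y)].
  + apply Hnew. cbn in Hv. intuition.
  + apply Hnew. cbn in Hv. intuition.
  + assert (HzL : In z L) by (destruct (HinT z Hz) as [?|[?|?]]; tauto).
    destruct (P3 z v HzL Hv) as [(k & K & ->)|O]; [|now right].
    left. exists k. split; [lia|reflexivity].
- intros z z' v Hz Hz' N1 N2.
  destruct (HinT z Hz) as [E|[E|(H1 & H2 & H3)]], (HinT z' Hz') as [E'|[E'|(H1' & H2' & H3')]];
    try (exfalso; subst z z'; congruence).
  + destruct (Nat.eq_dec z x); [|congruence]. destruct (Nat.eq_dec z' x); [congruence|].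
    destruct (Nat.eq_dec z' y); [congruence|].
    intros Hv Hv'. destruct (Hold z' v H3' Hv'). cbn in Hv. intuition congruence.
  + destruct (Nat.eq_dec z x); [congruence|]. destruct (Nat.eq_dec z y); [|congruence].
    destruct (Nat.eq_dec z' x); [congruence|]. destruct (Nat.eq_dec z' y); [congruence|].
    intros Hv Hv'. destruct (Hold z' v H3' Hv'). cbn in Hv. intuition congruence.
  + destruct (Nat.eq_dec z' x); [|congruence]. destruct (Nat.eq_dec z x); [congruence|].
    destruct (Nat.eq_dec z y); [congruence|].
    intros Hv Hv'. destruct (Hold z v H3 Hv). cbn in Hv'. intuition congruence.
  + destruct (Nat.eq_dec z' x); [congruence|]. destruct (Nat.eq_dec z' y); [|congruence].
    destruct (Nat.eq_dec z x); [congruence|]. destruct (Nat.eq_dec z y); [congruence|].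
    intros Hv Hv'. destruct (Hold z v H3 Hv). cbn in Hv'. intuition congruence.
  + destruct (Nat.eq_dec z x); [congruence|]. destruct (Nat.eq_dec z y); [congruence|].
    destruct (Nat.eq_dec z' x); [congruence|]. destruct (Nat.eq_dec z' y); [congruence|].
    now apply (P4 z z' v).
Qed.

Lemma paired_same L L' : NoDup L' -> (forall x, In x L <-> In x L') -> paired L -> paired L'.
Proof.
intros ND H (_ & H1 & H2). split; [exact ND|]. split.
- intros x Hx. apply H, H1, H, Hx.
- intros x Hx. apply H2, H, Hx.
Qed.

(** Induction on the number of tokens and, inside it, on the number of tokens between [x] and
    [pi x]. Each overtaking sends the token next to [x] to the end of the list; adjacent partners
    are joined and removed. *)
Theorem paired_routable L : paired L -> 2 * length L <= n -> routable L.
Proof.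
remember (length L) as m eqn:Hm. revert L Hm.
induction m as [m IHm] using (well_founded_induction lt_wf). intros L Hm HL Hn2.
destruct L as [|x L].
{ intros c Z pos _. exists (fun _ => []).
  split; [|split; [|split]]; [intros ? []|intros ? []|intros ? ? []|intros ? ? ? []]. }
assert (Hpx : In (pi x) L).
{ assert (H : In (pi x) (x :: L)) by (apply HL; cbn; auto).
  destruct H as [H|H]; [|exact H]. exfalso. apply (proj2 (proj2 HL) x); cbn; auto. }
apply in_split in Hpx. destruct Hpx as (L1 & L2 & ->).
remember (length L1) as k eqn:Hk. revert L1 L2 Hk Hm HL.
induction k as [|k IHk]; intros L1 L2 Hk Hm HL.
- destruct L1; [|discriminate]. cbn [app] in *. subst m.
  apply routable_join; auto.
  apply (IHm (length L2)); cbn in *; try lia.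
  destruct HL as (ND & H1 & H2). split; [|split].
  + now inversion_clear ND as [|? ? ? ND']; inversion_clear ND'.
  + intros z Hz. assert (H := H1 z ltac:(cbn; auto)).
    inversion_clear ND as [|? ? Nx ND']; inversion_clear ND' as [|? ? Ny _].
    destruct H as [E|[E|H]]; [| |exact H]; exfalso.
    * apply Ny. rewrite E, pi_invol. exact Hz.
    * apply Nx. cbn. right. rewrite <- (pi_invol x), E, pi_invol. exact Hz.
  + intros z Hz. apply H2. cbn. auto.
- destruct L1 as [|y L1]; [discriminate|]. injection Hk as Hk. cbn [app] in *.
  apply routable_overtake; auto; [now rewrite <- Hm|].
  rewrite <- app_assoc. cbn [app].
  apply IHk; auto.
  + rewrite Hm. cbn. rewrite !length_app. cbn. rewrite length_app. cbn. lia.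
  + apply (paired_same (x :: y :: L1 ++ pi x :: L2)); auto.
    * destruct HL as (ND & _).
      apply (Permutation.Permutation_NoDup (l := x :: y :: L1 ++ pi x :: L2)); [|exact ND].
      apply Permutation.perm_skip.
      change (L1 ++ pi x :: L2 ++ [y]) with (L1 ++ (pi x :: L2) ++ [y]).
      rewrite app_assoc. apply Permutation.Permutation_cons_append.
    * intros z. cbn. rewrite !in_app_iff. cbn. rewrite in_app_iff. cbn. tauto.
Qed.
End Routing.

(** * The subdivision *)

Section Tokens.
Local Open Scope nat_scope.
Context (t M : nat) (HM : t * t < M).

(* The end at hub [i] of the [k]-th path between the hubs [i] and [j]; it starts at the spiral vertex of the
   same number. *)
Definition token (i j k : nat) : nat := i * M + (j * t + k).

Definition is_token (x : nat) : bool := (x / M <? t) && (x mod M <? t * t).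

(** Made the identity off the tokens, since routing asks for an involution of all numbers. It also
    fixes the tokens with [i = j], which [tokens] therefore omits. *)
Definition partner (x : nat) : nat :=
  if is_token x then token (x mod M / t) (x / M) ((x mod M) mod t) else x.

Lemma is_token_spec x : is_token x = true <->
  exists i j k, i < t /\ j < t /\ k < t /\ x = token i j k.
Proof.
unfold is_token, token. rewrite Bool.andb_true_iff, !Nat.ltb_lt. split.
- intros [H1 H2]. exists (x / M), (x mod M / t), ((x mod M) mod t).
  split; [exact H1|]. split; [apply Nat.Div0.div_lt_upper_bound; lia|].
  split; [apply Nat.mod_upper_bound; lia|].
  rewrite (Nat.div_mod_eq x M) at 1. rewrite (Nat.div_mod_eq (x mod M) t) at 1. lia.
- intros (i & j & k & Hi & Hj & Hk & ->).
  assert (Hjk : j * t + k < t * t) by nia.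
  rewrite Nat.div_add_l, Nat.div_small by lia.
  rewrite (Nat.add_comm (i * M)), Nat.Div0.mod_add, Nat.mod_small by lia. lia.
Qed.

Lemma partner_token i j k : i < t -> j < t -> k < t -> partner (token i j k) = token j i k.
Proof.
intros Hi Hj Hk. unfold partner.
assert (H : is_token (token i j k) = true) by (apply is_token_spec; eauto 10).
rewrite H. unfold token at 2 3 4.
assert (Hjk : j * t + k < t * t) by nia.
replace ((i * M + (j * t + k)) / M) with i.
2:{ rewrite Nat.div_add_l, Nat.div_small; lia. }
replace ((i * M + (j * t + k)) mod M) with (j * t + k).
2:{ rewrite (Nat.add_comm (i * M)), Nat.Div0.mod_add, Nat.mod_small; lia. }
rewrite Nat.div_add_l, (Nat.div_small k t) by lia.
rewrite (Nat.add_comm (j * t)), Nat.Div0.mod_add, Nat.mod_small by lia.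
now rewrite Nat.add_0_r.
Qed.

Lemma token_inj i j k i' j' k' : i < t -> j < t -> k < t -> i' < t -> j' < t -> k' < t ->
  token i j k = token i' j' k' -> i = i' /\ j = j' /\ k = k'.
Proof.
unfold token. intros Hi Hj Hk Hi' Hj' Hk' E.
assert (H : j * t + k < M) by nia. assert (H' : j' * t + k' < M) by nia.
assert (i = i') by nia. subst i'. assert (j = j') by nia. subst j'. lia.
Qed.

Lemma partner_invol x : partner (partner x) = x.
Proof.
destruct (is_token x) eqn:H.
- apply is_token_spec in H. destruct H as (i & j & k & Hi & Hj & Hk & ->).
  now rewrite !partner_token.
- unfold partner at 2. rewrite H. unfold partner. now rewrite H.
Qed.

Definition tokens : list nat :=
  filter (fun x => (is_token x && negb (partner x =? x)%nat)%bool) (seq 0 (t * M)).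

Lemma in_tokens x : In x tokens <->
  exists i j k, i < t /\ j < t /\ k < t /\ i <> j /\ x = token i j k.
Proof.
unfold tokens. rewrite filter_In, in_seq, Bool.andb_true_iff, Bool.negb_true_iff, Nat.eqb_neq.
rewrite is_token_spec. split.
- intros (_ & (i & j & k & Hi & Hj & Hk & ->) & H). exists i, j, k. repeat split; auto.
  intros ->. apply H. now apply partner_token.
- intros (i & j & k & Hi & Hj & Hk & Hij & ->). repeat split.
  + lia.
  + unfold token. assert (j * t + k < t * t) by nia. nia.
  + eauto 10.
  + rewrite partner_token by auto. intros E. apply token_inj in E; auto. lia.
Qed.

Lemma tokens_paired : paired partner tokens.
Proof.
split; [apply NoDup_filter, seq_NoDup|]. split; intros x Hx; apply in_tokens in Hx;
  destruct Hx as (i & j & k & Hi & Hj & Hk & Hij & ->); rewrite partner_token by auto.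
- apply in_tokens. exists j, i, k. auto 10.
- intros E. apply token_inj in E; auto. lia.
Qed.

End Tokens.

Theorem mainTheorem6 (VU : Type) (adjU : VU -> VU -> Prop)
  (HU : countable_simple_graph adjU)
  (Huniv : forall (V : Type) (adj : V -> V -> Prop),
      countable_simple_graph adj -> planar adj -> contains adjU adj)
  (t : nat) :
  has_subdivision_Ktt adjU t.
Proof.
destruct HU as (Hsym & _ & code & Hcode).
(* Each hub needs [t * t] feet, and one more keeps [M] positive for [t = 0]. The summand
   [2 * (t * M)] bounds twice the number of tokens, and 6 is the least width assumed for events. *)
set (M := (t * t + 1)%nat). set (n := (2 * (t * M) + M + 6)%nat).
assert (HM1 : (1 <= M)%nat) by (unfold M; lia).
assert (HMt : (t * t < M)%nat) by (unfold M; lia).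
assert (HMn : (M < n)%nat) by (unfold n; lia).
assert (Hn2 : (2 <= n)%nat) by (unfold n; lia).
assert (Hn : (6 <= n)%nat) by (unfold n; lia).
assert (HtM : (t * M <= n)%nat) by (unfold n; lia).
assert (Hlen : (2 * (t * M) <= n)%nat) by (unfold n; lia).
clearbody M n.
assert (Hemb : forall al, exists f : spiral_vertex -> VU,
   (forall x y, f x = f y -> x = y) /\
   (forall x y, spiral_adj n t M al x y -> adjU (f x) (f y))).
{ intros al. apply Huniv; [now apply spiral_graph|now apply spiral_planar]. }
pose (f al := proj1_sig (constructive_indefinite_description _ (Hemb al))).
assert (Hf : forall al, (forall x y, f al x = f al y -> x = y) /\
   (forall x y, spiral_adj n t M al x y -> adjU (f al x) (f al y))).
{ intros al. exact (proj2_sig (constructive_indefinite_description _ (Hemb al))). }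
clearbody f. clear Hemb Huniv.
assert (Hedge : forall al e, valid_edge t M e ->
   adjU (f al (edge_src al e)) (f al (edge_tgt n al e))).
{ intros al e He. apply Hf. exists e. auto. }
assert (Hspiral : forall al, spiral_in adjU n t (fun k => f al (inl k)) (fun p => f al (inr p))).
{ intros al. split.
  - intros k k' E. apply Hf in E. congruence.
  - intros k. exact (Hedge al (arm k) I).
  - intros k. exact (Hedge al (radial k) I).
  - intros k p _ E. apply Hf in E. discriminate. }
destruct (exists_spiral_with_events adjU Hsym n t Hn code
  (fun al k => f al (inl k)) (fun al p => f al (inr p)) Hcode Hspiral) as [al Hev].
{ intros al k. assert (H := Hedge al (diagonal k) I). cbn in H.
  destruct (al k); exact H. }
set (g := fun k => f al (inl k)) in *. set (hub := fun p => f al (inr p)) in *.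
assert (Hhub : forall i j k, (i < t)%nat -> (j < t)%nat -> (k < t)%nat ->
   adjU (hub i) (g (token t M i j k))).
{ intros i j k Hi Hj Hk. apply (Hedge al (spoke i (token t M i j k))).
  cbn. unfold token. assert (j * t + k < t * t)%nat by nia. lia. }
destruct (paired_routable adjU Hsym n t Hn g hub (Hspiral al) (partner t M)
  (partner_invol t M HMt) Hev (tokens t M) (tokens_paired t M HMt)) with (c := 0%nat)
  (Z := @nil VU) (pos := fun x : nat => x) as (P & P1 & P2 & P3 & P4).
{ assert (H := filter_length_le (fun x => is_token t M x && negb (partner t M x =? x)%nat)%bool
    (seq 0 (t * M))). rewrite length_seq in H. unfold tokens. lia. }
{ split.
  - intros x Hx. unfold tokens in Hx. apply filter_In in Hx. destruct Hx as [Hx _].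
    apply in_seq in Hx. lia.
  - intros x y. apply index_filter_seq. }
assert (Hin : forall i j k, (i < j)%nat -> (j < t)%nat -> (k < t)%nat ->
   In (token t M i j k) (tokens t M)).
{ intros i j k Hij Hj Hk. apply (in_tokens t M HMt). exists i, j, k. repeat split; lia. }
assert (Hnothub : forall x v m, In x (tokens t M) -> In v (P x) -> (m < t)%nat -> v <> hub m).
{ intros x v m Hx Hv Hm. destruct (P3 x v Hx Hv) as [(k & _ & ->)|(_ & O & _)]; [|auto].
  now apply (spiral_not_hub _ _ _ _ _ (Hspiral al)). }
assert (Hdisj : forall i j k i' j' k' x, (i < j)%nat -> (j < t)%nat -> (k < t)%nat ->
   (i' < j')%nat -> (j' < t)%nat -> (k' < t)%nat -> (i, j, k) <> (i', j', k') ->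
   In x (P (token t M i j k)) -> ~ In x (P (token t M i' j' k'))).
{ intros i j k i' j' k' x H1 H2 H3 H4 H5 H6 Hne. apply P4; auto.
  - intros E. apply token_inj in E; try lia. apply Hne. now destruct E as (-> & -> & ->).
  - rewrite partner_token by lia. intros E. apply token_inj in E; lia. }
assert (Hhubinj : forall i j, hub i = hub j -> i = j).
{ intros i j E. apply Hf in E. congruence. }
exists hub, (fun i j k => P (token t M i j k)).
split; [|split; [|split; [|split]]].
- auto.
- intros i j k Hij Hj Hk. assert (HP := P1 _ (Hin i j k Hij Hj Hk)).
  rewrite partner_token in HP by lia. split.
  + apply (joins_walk adjU (g (token t M i j k)) _ (g (token t M j i k))); auto.
    * apply Hhub; lia.
    * apply Hsym, Hhub; lia.
  + constructor.
    * intros Hi. apply in_app_or in Hi. destruct Hi as [Hi|[Hi|[]]].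
      -- now apply (Hnothub _ _ i (Hin i j k Hij Hj Hk) Hi); [lia|].
      -- apply Hhubinj in Hi. lia.
    * apply NoDup_app; [apply P2; auto|repeat constructor; tauto|].
      intros v Hv [<-|[]]. now apply (Hnothub _ _ j (Hin i j k Hij Hj Hk) Hv).
- intros i j k m x Hij Hj Hk Hm Hx. eauto.
(* Every path has an interior vertex, so parallel paths with disjoint interiors are different. *)
- intros i j k k' Hij Hj Hk Hk' Hne E.
  destruct (P1 _ (Hin i j k Hij Hj Hk)) as (_ & Hhd & _).
  destruct (P (token t M i j k)) as [|a l] eqn:EP; [discriminate|].
  apply (Hdisj i j k i j k' a); auto.
  + congruence.
  + rewrite EP. cbn. auto.
  + rewrite <- E. cbn. auto.
- exact Hdisj.
Qed.
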